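(* Let $A$ be a separable quasidiagonal amenable $C^*$-algebra and let $C$ be a non-unital but $\sigma$-unital simple $C^*$-algebra which admits an approximate identity consisting of projections and has the property (SP). Then there exists an (essential) quasidiagonal extension $\tau: A\to M(C)/C$.
   Context: ''Amenable'' means nuclear. A separable $C^*$-algebra $A$ is quasidiagonal if there is a faithful representation $\phi:A\to B(H)$ on some separable Hilbert space $H$ and an approximate identity $\{p_n\}$ of the compact operators $\mathcal K$ on $H$ consisting of finite rank projections such that $\|p_n\phi(a)-\phi(a)p_n\|\to 0$ for all $a\in A$. A $C^*$-algebra has the property (SP) if every nonzero hereditary $C^*$-subalgebra contains a nonzero projection. $M(C)$ is the multiplier algebra of $C$ and $\pi:M(C)\to M(C)/C$ the quotient map. An essential extension of $A$ by $C$ is identified with its Busby invariant, a monomorphism $\tau: A\to M(C)/C$. It is quasidiagonal if, with $E=\pi^{-1}(\tau(A))$, there exists an approximate identity $\{e_n\}$ of $C$ consisting of projections such that $\lim_{n\to\infty}\|e_nb-be_n\|=0$ for all $b\in E$. *)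

(* Defs.v *)
From HB Require Import structures.
From mathcomp Require Import all_boot all_order all_algebra.
From mathcomp Require Import generic_quotient ring_quotient.
From mathcomp Require Import all_classical all_reals all_analysis.
From mathcomp Require Import complex.
Set Implicit Arguments.
Unset Strict Implicit.
Unset Printing Implicit Defensive.
Import Order.TTheory GRing.Theory Num.Theory.
Import numFieldNormedType.Exports.
Local Open Scope classical_set_scope.
Local Open Scope ring_scope.
Local Open Scope complex_scope.

(** * Star algebras and C*-algebras *)

(* Algebras are not assumed unital, so MathComp rings cannot be used. *)
HB.mixin Record Lmodule_isStarAlg (K : numClosedFieldType) A
    of GRing.Lmodule K A := {
  amul : A -> A -> A;
  star : A -> A;
  amulA : associative amul;
  amulDl : left_distributive amul +%R;
  amulDr : right_distributive amul +%R;
  amulZl : forall (k : K) x y, amul (k *: x) y = k *: amul x y;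
  amulZr : forall (k : K) x y, amul x (k *: y) = k *: amul x y;
  starK : involutive star;
  starD : {morph star : x y / x + y};
  starZ : forall (k : K) x, star (k *: x) = Num.conj k *: star x;
  starM : forall x y, star (amul x y) = amul (star y) (star x)
}.

#[short(type="starAlgType")]
HB.structure Definition StarAlg (K : numClosedFieldType) :=
  { A of Lmodule_isStarAlg K A & GRing.Lmodule K A }.

Notation "x ** y" := (amul x y) (at level 40, left associativity) : ring_scope.

Section StarAlgTheory.
Context {K : numClosedFieldType} {A : starAlgType K}.
Implicit Types x y : A.

Lemma amul0l x : 0 ** x = 0.
Proof. by have := amulZl 0 0 x; rewrite !scale0r. Qed.

Lemma amul0r x : x ** 0 = 0.
Proof. by have := amulZr 0 x 0; rewrite !scale0r. Qed.

Lemma amulBl x y z : (x - y) ** z = x ** z - y ** z.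
Proof. by rewrite amulDl -scaleN1r amulZl scaleN1r. Qed.

Lemma amulBr x y z : z ** (x - y) = z ** x - z ** y.
Proof. by rewrite amulDr -scaleN1r amulZr scaleN1r. Qed.

Lemma starB x y : star (x - y) = star x - star y.
Proof. by rewrite starD -scaleN1r starZ rmorphN rmorph1 scaleN1r. Qed.

End StarAlgTheory.

HB.mixin Record StarAlg_isCstarAlg (K : numClosedFieldType) A
    of StarAlg K A & CompleteNormedModule K A := {
  norm_amul : forall x y : A, `|x ** y| <= `|x| * `|y|;
  norm_star_amul : forall x : A, `|star x ** x| = `|x| ^+ 2
}.

#[short(type="cstarAlgType")]
HB.structure Definition CstarAlg (K : numClosedFieldType) :=
  { A of StarAlg_isCstarAlg K A & StarAlg K A & CompleteNormedModule K A }.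

Lemma norm_star (K : numClosedFieldType) (A : cstarAlgType K) (x : A) :
  `|star x| = `|x|.
Proof.
suff le_star (y : A) : `|y| <= `|star y|.
  by apply/le_anti; rewrite le_star -{2}(starK x) le_star.
have [->|y0] := eqVneq y 0; first by rewrite normr0.
have := norm_amul (star y) y; rewrite norm_star_amul expr2.
by rewrite ler_pM2r// normr_gt0.
Qed.

Section StarAlgNotions.
Context {K : numClosedFieldType}.

Definition star_hom (A B : starAlgType K) (f : A -> B) : Prop :=
  [/\ linear f, {morph f : x y / x ** y} & {morph f : x / star x}].

Definition positive (A : starAlgType K) (a : A) : Prop :=
  exists x, a = star x ** x.

Definition projection (A : starAlgType K) (p : A) : Prop :=
  star p = p /\ p ** p = p.

Definition unital (A : starAlgType K) : Prop :=
  exists u : A, forall a, u ** a = a /\ a ** u = a.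

End StarAlgNotions.

Section CstarAlgNotions.
Context {K : numClosedFieldType} (A : cstarAlgType K).

Definition cstar_subalgebra (B : set A) : Prop :=
  [/\ closed B, B 0,
      forall k x y, B x -> B y -> B (k *: x + y),
      forall x y, B x -> B y -> B (x ** y)
    & forall x, B x -> B (star x)].

Definition hereditary (B : set A) : Prop :=
  cstar_subalgebra B /\
  forall a b, positive a -> positive (b - a) -> B b -> B a.

Definition property_SP : Prop :=
  forall B : set A, hereditary B -> (exists2 b, B b & b != 0) ->
    exists p, [/\ B p, projection p & p != 0].

Definition closed_ideal (J : set A) : Prop :=
  [/\ closed J, J 0,
      forall k x y, J x -> J y -> J (k *: x + y)
    & forall a x, J x -> J (a ** x) /\ J (x ** a)].

Definition simple : Prop :=
  forall J : set A, closed_ideal J -> J = [set 0] \/ J = setT.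

Definition directed (I : Type) (le : I -> I -> Prop) : Prop :=
  [/\ inhabited I, forall i, le i i,
      forall i j k, le i j -> le j k -> le i k
    & forall i j, exists k, le i k /\ le j k].

(* An increasing net of positive contractions. *)
Definition approximate_identity (I : Type) (le : I -> I -> Prop)
    (e : I -> A) : Prop :=
  [/\ directed le,
      forall i, positive (e i) /\ `|e i| <= 1,
      forall i j, le i j -> positive (e j - e i)
    & forall (a : A) (eps : K), 0 < eps -> exists i0, forall i, le i0 i ->
        `|e i ** a - a| < eps /\ `|a ** e i - a| < eps].

Definition leN (m n : nat) : Prop := (m <= n)%N.

Definition sigma_unital : Prop :=
  exists e : nat -> A, approximate_identity leN e.

Definition has_projection_approximate_identity : Prop :=
  exists (I : Type) (le : I -> I -> Prop) (e : I -> A),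
    approximate_identity le e /\ forall i, projection (e i).

End CstarAlgNotions.

Definition separable (T : topologicalType) : Prop :=
  exists2 D : set T, countable D & dense D.

(** * Nuclearity (completely positive approximation property) *)

Section MatrixStarAlg.
Variables (K : numClosedFieldType) (k : nat).

Definition mxadj (M : 'M[K]_k) : 'M[K]_k := map_mx Num.conj M^T.

Fact mxadjK : involutive mxadj.
Proof. by move=> M; apply/matrixP => i j; rewrite !mxE conjCK. Qed.

Fact mxadjD : {morph mxadj : M N / M + N}.
Proof. by move=> M N; apply/matrixP => i j; rewrite !mxE rmorphD. Qed.

Fact mxadjZ (c : K) M : mxadj (c *: M) = Num.conj c *: mxadj M.
Proof. by apply/matrixP => i j; rewrite !mxE rmorphM. Qed.

Fact mxadjM M N : mxadj (M *m N) = mxadj N *m mxadj M.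
Proof. by rewrite /mxadj trmx_mul map_mxM. Qed.

HB.instance Definition _ := Lmodule_isStarAlg.Build K 'M[K]_k
  (@mulmxA K k k k k) (@mulmxDl K k k k) (@mulmxDr K k k k)
  (fun c M N => esym (scalemxAl c M N)) (fun c M N => esym (scalemxAr c M N))
  mxadjK mxadjD mxadjZ mxadjM.

End MatrixStarAlg.

Section CompletelyPositive.
Context {K : numClosedFieldType}.

(* [amx_mul] and [amx_star] make ['M[A]_n] the star algebra M_n(A). *)
Definition amx_mul (A : starAlgType K) n (X Y : 'M[A]_n) : 'M[A]_n :=
  \matrix_(i, j) \sum_l X i l ** Y l j.

Definition amx_star (A : starAlgType K) n (X : 'M[A]_n) : 'M[A]_n :=
  \matrix_(i, j) star (X j i).

Definition amx_positive (A : starAlgType K) n (X : 'M[A]_n) : Prop :=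
  exists Y, X = amx_mul (amx_star Y) Y.

Definition completely_positive (A B : starAlgType K) (f : A -> B) : Prop :=
  linear f /\
  forall n (X : 'M[A]_n), amx_positive X -> amx_positive (map_mx f X).

End CompletelyPositive.

Section OperatorNorm.
Context {R : realType}.

Definition opnorm (V W : normedModType R[i]) (f : V -> W) : R :=
  sup [set complex.Re `|f x| | x in [set x : V | `|x| <= 1]].

Definition bounded_linear (V W : normedModType R[i]) (f : V -> W) : Prop :=
  linear f /\ exists c : R[i], forall x, `|f x| <= c * `|x|.

(* MathComp-Analysis norms matrices by the maximum of the entries; here
   M_k(C) carries the norm of operators on the Euclidean space C^k. *)
Definition l2norm k (x : 'cV[R[i]]_k) : R :=
  Num.sqrt (\sum_i complex.Re `|x i 0| ^+ 2).

Definition mx_opnorm k (M : 'M[R[i]]_k) : R :=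
  sup [set l2norm (M *m x) | x in [set x | l2norm x <= 1]].

Definition nuclear (A : cstarAlgType R[i]) : Prop :=
  forall (F : seq A) (eps : R), 0 < eps ->
    exists (k : nat) (f : A -> 'M[R[i]]_k) (g : 'M[R[i]]_k -> A),
      [/\ completely_positive f, completely_positive g,
          forall a, mx_opnorm (f a) <= complex.Re `|a|,
          forall M, complex.Re `|g M| <= mx_opnorm M
        & forall a, a \in F -> `|g (f a) - a| < eps%:C].

End OperatorNorm.

(** * Hilbert spaces and quasidiagonality *)

HB.mixin Record CompleteNormedModule_isHilbert (K : numClosedFieldType) H
    of CompleteNormedModule K H := {
  inner : H -> H -> K;
  inner_linear : forall y, scalar (inner^~ y);
  inner_conj : forall x y, inner y x = Num.conj (inner x y);
  inner_norm : forall x, inner x x = `|x| ^+ 2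
}.

#[short(type="hilbertType")]
HB.structure Definition Hilbert (K : numClosedFieldType) :=
  { H of CompleteNormedModule_isHilbert K H & CompleteNormedModule K H }.

Section Quasidiagonal.
Context {R : realType}.

(* A star homomorphism from [A] to B(H), where adjoints in B(H) are
   characterized by [inner (T x) y = inner x (T^* y)]. *)
Definition representation (A : cstarAlgType R[i]) (H : hilbertType R[i])
    (phi : A -> H -> H) : Prop :=
  [/\ forall a, bounded_linear (phi a),
      forall k a b x, phi (k *: a + b) x = k *: phi a x + phi b x,
      forall a b x, phi (a ** b) x = phi a (phi b x)
    & forall a x y, inner (phi a x) y = inner x (phi (star a) y)].

Definition orthogonal_projection (H : hilbertType R[i]) (p : H -> H) : Prop :=
  [/\ bounded_linear p, forall x, p (p x) = p x
    & forall x y, inner (p x) y = inner x (p y)].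

Definition finite_rank (H : hilbertType R[i]) (T : H -> H) : Prop :=
  exists (n : nat) (v : 'I_n -> H),
    forall x, exists c : 'I_n -> R[i], T x = \sum_i c i *: v i.

Definition compact_operator (H : hilbertType R[i]) (T : H -> H) : Prop :=
  bounded_linear T /\ compact (closure (T @` [set x | `|x| <= 1])).

(* For projections, [p m <= p n] in B(H) means that the range of [p n]
   contains the range of [p m]. *)
Definition finite_rank_approximate_identity (H : hilbertType R[i])
    (p : nat -> H -> H) : Prop :=
  [/\ forall n, orthogonal_projection (p n) /\ finite_rank (p n),
      forall m n, (m <= n)%N -> range (p m) `<=` range (p n)
    & forall T, compact_operator T ->
        opnorm (fun x => p n (T x) - T x) @[n --> \oo] --> 0 /\
        opnorm (fun x => T (p n x) - T x) @[n --> \oo] --> 0].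

Definition quasidiagonal (A : cstarAlgType R[i]) : Prop :=
  exists (H : hilbertType R[i]) (phi : A -> H -> H) (p : nat -> H -> H),
    [/\ separable H, representation phi, injective phi,
        finite_rank_approximate_identity p
      & forall a,
          opnorm (fun x => p n (phi a x) - phi a (p n x)) @[n --> \oo] --> 0].

End Quasidiagonal.

(** * The multiplier algebra, as the algebra of double centralizers *)

Section Multiplier.
Context {R : realType} (C : cstarAlgType R[i]).

Definition double_centralizer (LR : (C -> C) * (C -> C)) : Prop :=
  [/\ bounded_linear LR.1, bounded_linear LR.2,
      forall a b, LR.1 (a ** b) = LR.1 a ** b,
      forall a b, LR.2 (a ** b) = a ** LR.2 b
    & forall a b, LR.2 a ** b = a ** LR.1 b].

Definition is_double_centralizer : pred ((C -> C) * (C -> C)) :=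
  fun LR => `[< double_centralizer LR >].

Record multiplier := Multiplier {
  mult_val : (C -> C) * (C -> C);
  mult_valP : is_double_centralizer mult_val }.

HB.instance Definition _ := [isSub for mult_val].
HB.instance Definition _ := [Choice of multiplier by <:].

Definition lmult (m : multiplier) : C -> C := (mult_val m).1.
Definition rmult (m : multiplier) : C -> C := (mult_val m).2.

Lemma multiplierP (m : multiplier) : double_centralizer (lmult m, rmult m).
Proof. by apply/asboolP; rewrite -surjective_pairing; exact: mult_valP. Qed.

Lemma multiplier_eq (m n : multiplier) :
  lmult m =1 lmult n -> rmult m =1 rmult n -> m = n.
Proof.
move=> /funext ml /funext mr; apply: val_inj => /=.
by rewrite [LHS]surjective_pairing [RHS]surjective_pairing; congr pair.
Qed.

Lemma bounded_linear_lin (V W : normedModType R[i]) k (f g : V -> W) :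
  bounded_linear f -> bounded_linear g ->
  bounded_linear (fun x => k *: f x + g x).
Proof.
move=> [lf [c cf]] [lg [d dg]]; split.
  move=> a x y; rewrite lf lg !scalerDr !scalerA (mulrC k a).
  by rewrite addrACA.
exists (`|k| * c + d) => x; rewrite (le_trans (ler_normD _ _))//.
by rewrite mulrDl lerD// normrZ -mulrA ler_wpM2l.
Qed.

Lemma bounded_linear_comp (U V W : normedModType R[i])
    (f : U -> V) (g : V -> W) :
  bounded_linear f -> bounded_linear g -> bounded_linear (g \o f).
Proof.
move=> [lf [c cf]] [lg [d dg]]; split.
  by move=> a x y; rewrite /= lf lg.
exists (`|d| * c) => x; rewrite /= -mulrA.
apply: (@le_trans _ _ (`|d| * `|f x|)); last exact: ler_wpM2l.
have [->|fx0] := eqVneq (f x) 0.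
  by move: (dg 0); rewrite normr0 !mulr0.
apply: le_trans (dg _) _.
have d0 : 0 <= d by rewrite -(pmulr_lge0 d (x := `|f x|)) ?normr_gt0// (le_trans _ (dg _)).
by rewrite ger0_norm.
Qed.

Lemma double_centralizer_submod : submod_closed is_double_centralizer.
Proof.
have zero_bl : bounded_linear (fun _ : C => 0 : C).
  split; first by move=> k x y; rewrite scaler0 addr0.
  by exists 0 => x; rewrite normr0 mul0r.
split.
  apply/asboolP; split => //= a b.
  - by rewrite amul0l.
  - by rewrite amul0r.
  - by rewrite amul0l amul0r.
move=> k [L1 R1] [L2 R2] /asboolP[/= bL1 bR1 L1M R1M LR1].
move=> /asboolP[/= bL2 bR2 L2M R2M LR2]; apply/asboolP; split => /=.
- exact: bounded_linear_lin.
- exact: bounded_linear_lin.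
- by move=> a b; rewrite ?fctE L1M L2M amulDl amulZl.
- by move=> a b; rewrite ?fctE R1M R2M amulDr amulZr.
- by move=> a b; rewrite ?fctE amulDl amulDr amulZl amulZr LR1 LR2.
Qed.

HB.instance Definition _ := GRing.isSubmodClosed.Build R[i]
  ((C -> C) * (C -> C))%type is_double_centralizer double_centralizer_submod.
HB.instance Definition _ :=
  [SubChoice_isSubLmodule of multiplier by <:].

Definition mult_mul_val (m n : multiplier) : (C -> C) * (C -> C) :=
  (lmult m \o lmult n, rmult n \o rmult m).

Lemma mult_mul_valP m n : is_double_centralizer (mult_mul_val m n).
Proof.
have [/= bL1 bR1 L1M R1M LR1] := multiplierP m.
have [/= bL2 bR2 L2M R2M LR2] := multiplierP n.
apply/asboolP; split => /=; try exact: bounded_linear_comp.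
- by move=> a b; rewrite L2M L1M.
- by move=> a b; rewrite R1M R2M.
- by move=> a b; rewrite LR2 LR1.
Qed.

Definition mult_mul m n := Multiplier (mult_mul_valP m n).

Definition mult_star_val (m : multiplier) : (C -> C) * (C -> C) :=
  (fun a => star (rmult m (star a)), fun a => star (lmult m (star a))).

Lemma bounded_linear_star (f : C -> C) :
  bounded_linear f -> bounded_linear (fun a => star (f (star a))).
Proof.
move=> [lf [c cf]]; split.
  by move=> k x y; rewrite starD starZ lf starD starZ conjCK.
by exists c => x; rewrite norm_star (le_trans (cf _))// norm_star.
Qed.

Lemma mult_star_valP m : is_double_centralizer (mult_star_val m).
Proof.
have [/= bL bR LM RM LR] := multiplierP m.
apply/asboolP; split => /=; try exact: bounded_linear_star.
- by move=> a b; rewrite starM RM starM starK.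
- by move=> a b; rewrite starM LM starM starK.
- by move=> a b; rewrite -{1}(starK b) -starM -LR starM starK.
Qed.

Definition mult_star m := Multiplier (mult_star_valP m).

Fact lmultD m n a : lmult (m + n) a = lmult m a + lmult n a.
Proof. by []. Qed.

Fact rmultD m n a : rmult (m + n) a = rmult m a + rmult n a.
Proof. by []. Qed.

Fact lmultZ (k : R[i]) m a : lmult (k *: m) a = k *: lmult m a.
Proof. by []. Qed.

Fact rmultZ (k : R[i]) m a : rmult (k *: m) a = k *: rmult m a.
Proof. by []. Qed.

Fact lmult_mul m n a : lmult (mult_mul m n) a = lmult m (lmult n a).
Proof. by []. Qed.

Fact rmult_mul m n a : rmult (mult_mul m n) a = rmult n (rmult m a).
Proof. by []. Qed.

Fact lmult_star m a : lmult (mult_star m) a = star (rmult m (star a)).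
Proof. by []. Qed.

Fact rmult_star m a : rmult (mult_star m) a = star (lmult m (star a)).
Proof. by []. Qed.

Definition multE := (lmultD, rmultD, lmultZ, rmultZ, lmult_mul, rmult_mul,
  lmult_star, rmult_star).

Fact mult_mulA : associative mult_mul.
Proof. by move=> m n p; apply: multiplier_eq => a; rewrite !multE. Qed.

Fact mult_mulDl : left_distributive mult_mul +%R.
Proof.
move=> m n p; apply: multiplier_eq => a; rewrite !multE //.
have [/= _ [lR _] _ _ _] := multiplierP p.
by have := lR 1 (rmult m a) (rmult n a); rewrite !scale1r.
Qed.

Fact mult_mulDr : right_distributive mult_mul +%R.
Proof.
move=> m n p; apply: multiplier_eq => a; rewrite !multE //.
have [/= [lL _] _ _ _ _] := multiplierP m.
by have := lL 1 (lmult n a) (lmult p a); rewrite !scale1r.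
Qed.

Fact mult_mulZl (k : R[i]) m n : mult_mul (k *: m) n = k *: mult_mul m n.
Proof.
apply: multiplier_eq => a; rewrite !multE //.
have [/= _ [lR _] _ _ _] := multiplierP n.
exact: (scalable_linear lR).
Qed.

Fact mult_mulZr (k : R[i]) m n : mult_mul m (k *: n) = k *: mult_mul m n.
Proof.
apply: multiplier_eq => a; rewrite !multE //.
have [/= [lL _] _ _ _ _] := multiplierP m.
exact: (scalable_linear lL).
Qed.

Fact mult_starK : involutive mult_star.
Proof. by move=> m; apply: multiplier_eq => a; rewrite !multE !starK. Qed.

Fact mult_starD : {morph mult_star : m n / m + n}.
Proof. by move=> m n; apply: multiplier_eq => a; rewrite !multE starD. Qed.

Fact mult_starZ (k : R[i]) m :
  mult_star (k *: m) = Num.conj k *: mult_star m.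
Proof. by apply: multiplier_eq => a; rewrite !multE starZ. Qed.

Fact mult_starM m n :
  mult_star (mult_mul m n) = mult_mul (mult_star n) (mult_star m).
Proof. by apply: multiplier_eq => a; rewrite !multE starK. Qed.

HB.instance Definition _ := Lmodule_isStarAlg.Build R[i] multiplier
  mult_mulA mult_mulDl mult_mulDr mult_mulZl mult_mulZr
  mult_starK mult_starD mult_starZ mult_starM.

(* The norm of M(C); left and right multiplication have equal norms. *)
Definition mult_norm (m : multiplier) : R := opnorm (lmult m).

Definition mult_of_val (c : C) : (C -> C) * (C -> C) :=
  (fun a => c ** a, fun a => a ** c).

Lemma mult_of_valP c : is_double_centralizer (mult_of_val c).
Proof.
apply/asboolP; split => /=.
- split; first by move=> k x y; rewrite amulDr amulZr.
  by exists `|c| => x; exact: norm_amul.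
- split; first by move=> k x y; rewrite amulDl amulZl.
  by exists `|c| => x; rewrite mulrC; exact: norm_amul.
- by move=> a b; rewrite amulA.
- by move=> a b; rewrite amulA.
- by move=> a b; rewrite amulA.
Qed.

Definition mult_of (c : C) : multiplier := Multiplier (mult_of_valP c).

Lemma mult_of_linear : linear mult_of.
Proof.
move=> k x y; apply: multiplier_eq => a.
  by rewrite /lmult/= amulDl amulZl.
by rewrite /rmult/= amulDr amulZr.
Qed.

Lemma mult_of_mull m c : m ** mult_of c = mult_of (lmult m c).
Proof.
have [/= _ _ LM _ LR] := multiplierP m.
by apply: multiplier_eq => a; [exact: LM|exact: LR].
Qed.

Lemma mult_of_mulr m c : mult_of c ** m = mult_of (rmult m c).
Proof.
have [/= _ _ _ RM LR] := multiplierP m.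
by apply: multiplier_eq => a; [exact/esym/LR|exact: RM].
Qed.

Lemma mult_of_star c : star (mult_of c) = mult_of (star c).
Proof. by apply: multiplier_eq => a; rewrite /lmult /rmult/= starM starK. Qed.

(** * The corona algebra M(C)/C *)

(* Only the star algebra structure of the quotient is needed: an injective
   star homomorphism between C*-algebras is automatically isometric. *)

Definition in_base (m : multiplier) : bool := `[< exists c, m = mult_of c >].

Lemma in_base_submod : submod_closed in_base.
Proof.
split.
  apply/asboolP; exists 0; apply: multiplier_eq => a.
    by rewrite /lmult/= amul0l.
  by rewrite /rmult/= amul0r.
move=> k _ _ /asboolP[c ->] /asboolP[d ->].
by apply/asboolP; exists (k *: c + d); rewrite mult_of_linear.
Qed.

HB.instance Definition _ :=
  GRing.isSubmodClosed.Build R[i] multiplier in_base in_base_submod.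

Lemma in_base_mull m n : n \in in_base -> m ** n \in in_base.
Proof.
by move=> /asboolP[c ->]; apply/asboolP; exists (lmult m c); rewrite mult_of_mull.
Qed.

Lemma in_base_mulr m n : m \in in_base -> m ** n \in in_base.
Proof.
by move=> /asboolP[c ->]; apply/asboolP; exists (rmult n c); rewrite mult_of_mulr.
Qed.

Lemma in_base_star m : m \in in_base -> star m \in in_base.
Proof.
by move=> /asboolP[c ->]; apply/asboolP; exists (star c); rewrite mult_of_star.
Qed.

Definition in_base_closed := GRing.ZmodClosed.clone _ in_base _.

Definition corona : Type := Quotient.quot in_base_closed.
HB.instance Definition _ := GRing.Zmodule.on corona.

Definition corona_pi : multiplier -> corona := \pi_(Quotient.quot in_base_closed)%qT.

Lemma corona_pi_eq m n : corona_pi m = corona_pi n <-> m - n \in in_base.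
Proof.
rewrite (Quotient.idealrBE in_base_closed).
by split => [mn|/eqP]; first exact/eqP.
Qed.

Lemma corona_piD : {morph corona_pi : m n / m + n}.
Proof. by move=> m n; exact: pi_addr. Qed.

Definition corona_repr (x : corona) : multiplier := repr (x : Quotient.quot in_base_closed).

Fact corona_reprK x : corona_pi (corona_repr x) = x.
Proof. exact: reprK. Qed.

Fact corona_repr_pi m : corona_repr (corona_pi m) - m \in in_base.
Proof. by apply/corona_pi_eq; rewrite corona_reprK. Qed.

Definition corona_scale (k : R[i]) x := corona_pi (k *: corona_repr x).
Definition corona_mul x y := corona_pi (corona_repr x ** corona_repr y).
Definition corona_star x := corona_pi (star (corona_repr x)).

Fact corona_pi_scale k m : corona_scale k (corona_pi m) = corona_pi (k *: m).
Proof. by apply/corona_pi_eq; rewrite -scalerBr rpredZ // corona_repr_pi. Qed.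

Fact corona_pi_mul m n : corona_mul (corona_pi m) (corona_pi n) = corona_pi (m ** n).
Proof.
apply/corona_pi_eq; set m' := corona_repr _; set n' := corona_repr _.
rewrite -(subrKA (m ** n')) -amulBl -amulBr rpredD //.
  exact/in_base_mulr/corona_repr_pi.
exact/in_base_mull/corona_repr_pi.
Qed.

Fact corona_pi_star m : corona_star (corona_pi m) = corona_pi (star m).
Proof. by apply/corona_pi_eq; rewrite -starB in_base_star // corona_repr_pi. Qed.

Fact coronaP (P : corona -> Prop) : (forall m, P (corona_pi m)) -> forall x, P x.
Proof. by move=> Ppi x; rewrite -(corona_reprK x). Qed.

Fact corona_scaleA a b x :
  corona_scale a (corona_scale b x) = corona_scale (a * b) x.
Proof. by elim/coronaP: x => m; rewrite !corona_pi_scale scalerA. Qed.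

Fact corona_scale1 : left_id 1 corona_scale.
Proof. by elim/coronaP => m; rewrite corona_pi_scale scale1r. Qed.

Fact corona_scaleDr : right_distributive corona_scale +%R.
Proof.
move=> k; elim/coronaP => m; elim/coronaP => n.
by rewrite -corona_piD !corona_pi_scale -corona_piD scalerDr.
Qed.

Fact corona_scaleDl x : {morph corona_scale^~ x : a b / a + b}.
Proof.
by elim/coronaP: x => m a b; rewrite !corona_pi_scale -corona_piD scalerDl.
Qed.

HB.instance Definition _ := GRing.Zmodule_isLmodule.Build R[i] corona
  corona_scaleA corona_scale1 corona_scaleDr corona_scaleDl.

Fact corona_mulA : associative corona_mul.
Proof.
elim/coronaP => m; elim/coronaP => n; elim/coronaP => p.
by rewrite !corona_pi_mul amulA.
Qed.

Fact corona_mulDl : left_distributive corona_mul +%R.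
Proof.
elim/coronaP => m; elim/coronaP => n; elim/coronaP => p.
by rewrite -corona_piD !corona_pi_mul -corona_piD amulDl.
Qed.

Fact corona_mulDr : right_distributive corona_mul +%R.
Proof.
elim/coronaP => m; elim/coronaP => n; elim/coronaP => p.
by rewrite -corona_piD !corona_pi_mul -corona_piD amulDr.
Qed.

Fact corona_mulZl (k : R[i]) x y : corona_mul (k *: x) y = k *: corona_mul x y.
Proof.
elim/coronaP: x => m; elim/coronaP: y => n; rewrite /GRing.scale/=.
by rewrite !(corona_pi_scale, corona_pi_mul) amulZl.
Qed.

Fact corona_mulZr (k : R[i]) x y : corona_mul x (k *: y) = k *: corona_mul x y.
Proof.
elim/coronaP: x => m; elim/coronaP: y => n; rewrite /GRing.scale/=.
by rewrite !(corona_pi_scale, corona_pi_mul) amulZr.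
Qed.

Fact corona_starK : involutive corona_star.
Proof. by elim/coronaP => m; rewrite !corona_pi_star starK. Qed.

Fact corona_starD : {morph corona_star : x y / x + y}.
Proof.
elim/coronaP => m; elim/coronaP => n.
by rewrite -corona_piD !corona_pi_star -corona_piD starD.
Qed.

Fact corona_starZ (k : R[i]) x :
  corona_star (k *: x) = Num.conj k *: corona_star x.
Proof.
elim/coronaP: x => m; rewrite /GRing.scale/=.
by rewrite !(corona_pi_scale, corona_pi_star) starZ.
Qed.

Fact corona_starM x y :
  corona_star (corona_mul x y) = corona_mul (corona_star y) (corona_star x).
Proof.
elim/coronaP: x => m; elim/coronaP: y => n.
by rewrite !(corona_pi_mul, corona_pi_star) starM.
Qed.

HB.instance Definition _ := Lmodule_isStarAlg.Build R[i] corona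
  corona_mulA corona_mulDl corona_mulDr corona_mulZl corona_mulZr
  corona_starK corona_starD corona_starZ corona_starM.

Lemma corona_pi_star_hom : star_hom corona_pi.
Proof.
split => [k m n|m n|m].
- by rewrite corona_piD -corona_pi_scale.
- by rewrite -corona_pi_mul.
- by rewrite -corona_pi_star.
Qed.

End Multiplier.

(** * Extensions, given by their Busby invariants *)

Section Extension.
Context {R : realType} (A C : cstarAlgType R[i]).

(* Injectivity of the Busby invariant is what makes the extension essential. *)
Definition essential_extension (tau : A -> corona C) : Prop :=
  star_hom tau /\ injective tau.

Definition extension_algebra (tau : A -> corona C) : set (multiplier C) :=
  @corona_pi R C @^-1` range tau.

Definition quasidiagonal_extension (tau : A -> corona C) : Prop :=
  exists e : nat -> C,
    [/\ approximate_identity leN e, forall n, projection (e n)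
      & forall b, extension_algebra tau b ->
          mult_norm (mult_of (e n) ** b - b ** mult_of (e n))
            @[n --> \oo] --> 0].

End Extension.

(* Main.v *)
(** Let p_n be the finite rank projections on H that asymptotically commute
    with A, as given by the quasidiagonality of A. The compressions p_n a p_n are
    asymptotically multiplicative maps into matrix algebras of size rank p_n,
    and p_n -> 1 strongly keeps them from vanishing asymptotically on a <> 0.

    In C, the approximate identity has an increasing subsequence g_n of
    projections, strictly increasing infinitely often since C is not unital.
    Thus there are arbitrarily many mutually orthogonal nonzero projections,
    and simplicity together with (SP) yields equivalent nonzero subprojections,
    that is, matrix units. After passing to a subsequence the corner of
    g_(n+1) - g_n contains a copy psi_n(a) of p_n a p_n. The strictly convergent
    sum Phi(a) of the psi_n(a) commutes with every g_n, is multiplicative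
    modulo C, and lies in C only if a = 0; hence tau is Phi modulo C.

    Order properties of C-star-algebras (existence of square roots,
    x^* x >= 0) are derived from norm estimates by power iterations,
    without spectral theory. *)
Require Import Defs.
From mathcomp Require Import all_boot all_order all_algebra.
From mathcomp Require Import all_classical all_reals all_analysis.
From mathcomp Require Import complex ring lra.
Set Implicit Arguments.
Unset Strict Implicit.
Unset Printing Implicit Defensive.
Import Order.TTheory GRing.Theory Num.Theory.
Import numFieldNormedType.Exports.
Local Open Scope classical_set_scope.
Local Open Scope ring_scope.
Local Open Scope complex_scope.

(** The ranks of the p_n are unbounded in general, so an estimate that loses a factor depending on
    the rank is useless: strict convergence of the sum needs blocks bounded uniformly in n, and the
    defects psi_n(ab) - psi_n(a) psi_n(b) have to tend to 0 in norm. One device gives both. The norm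
    of the 2^k-th power of a self-adjoint element is the 2^k-th power of its norm, so a factor C + D
    2^k in front of such powers disappears as k grows. The same device bounds the norm of an
    orthogonal sum by the largest norm of its terms. Hence defects that tend to 0, at whatever rate,
    already sum to an element of C. Simplicity enters through primeness: q C r is nonzero for
    nonzero projections q and r. A nonzero x in it has a polar part once it is cut down to a
    projection, supplied by (SP), on which x^* x is invertible. Since C has no unit, positivity is
    treated in corners e C e, and statements about all of C are reached by compressing with
    projections that almost fix the elements involved. *)

(** * Deciding identities between noncommutative polynomials *)

Section NonCommutativeNormalization.
Context {K : numClosedFieldType} {A : starAlgType K}.

(* Identities between noncommutative polynomials are decided by comparing
   coefficients of words: [(k, (i, w))] stands for k times the word [i w]. *)
Inductive ncexp :=
  | NVar of nat
  | NZero
  | NAdd of ncexp & ncexp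
  | NOpp of ncexp
  | NMul of ncexp & ncexp
  | NScale of K & ncexp.

Fixpoint nceval (env : seq A) (e : ncexp) : A :=
  match e with
  | NVar i => nth 0 env i
  | NZero => 0
  | NAdd e1 e2 => nceval env e1 + nceval env e2
  | NOpp e1 => - nceval env e1
  | NMul e1 e2 => nceval env e1 ** nceval env e2
  | NScale k e1 => k *: nceval env e1
  end.

(** Without a unit there is no empty word, so the first letter is passed separately, as the
    accumulator [x]. *)
Fixpoint ncword (env : seq A) (x : A) (w : seq nat) : A :=
  if w is i :: w' then ncword env (x ** nth 0 env i) w' else x.

Definition ncmon := (K * (nat * seq nat))%type.

Definition ncmoneval env (m : ncmon) : A :=
  m.1 *: ncword env (nth 0 env m.2.1) m.2.2.

Fixpoint ncden env (p : seq ncmon) : A :=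
  if p is m :: p' then ncmoneval env m + ncden env p' else 0.

Fixpoint ncopp (p : seq ncmon) : seq ncmon :=
  if p is m :: p' then (- m.1, m.2) :: ncopp p' else [::].

Fixpoint ncscale k (p : seq ncmon) : seq ncmon :=
  if p is m :: p' then (k * m.1, m.2) :: ncscale k p' else [::].

(** Concatenation and the equality tests below are redefined so that [nc_norm] can unfold exactly
    these constants and leave the coefficients in [K] alone. *)
Fixpoint nccat (T : Type) (p q : seq T) : seq T :=
  if p is m :: p' then m :: nccat p' q else q.

Fixpoint ncmulm (m : ncmon) (p : seq ncmon) : seq ncmon :=
  if p is n :: p' then
    (m.1 * n.1, (m.2.1, nccat m.2.2 (n.2.1 :: n.2.2))) :: ncmulm m p'
  else [::].

Fixpoint ncmul (p q : seq ncmon) : seq ncmon :=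
  if p is m :: p' then nccat (ncmulm m q) (ncmul p' q) else [::].

Fixpoint ncnorm (e : ncexp) : seq ncmon :=
  match e with
  | NVar i => [:: (1, (i, [::]))]
  | NZero => [::]
  | NAdd e1 e2 => nccat (ncnorm e1) (ncnorm e2)
  | NOpp e1 => ncopp (ncnorm e1)
  | NMul e1 e2 => ncmul (ncnorm e1) (ncnorm e2)
  | NScale k e1 => ncscale k (ncnorm e1)
  end.

Fixpoint nceqn (m n : nat) : bool :=
  match m, n with
  | 0%N, 0%N => true | m'.+1, n'.+1 => nceqn m' n' | _, _ => false
  end.

Fixpoint nceqw (v w : seq nat) : bool :=
  match v, w with
  | [::], [::] => true
  | i :: v', j :: w' => if nceqn i j then nceqw v' w' else false
  | _, _ => false
  end.

Fixpoint ncinsert (m : ncmon) (p : seq ncmon) : seq ncmon :=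
  if p is n :: p' then
    if nceqw (m.2.1 :: m.2.2) (n.2.1 :: n.2.2) then (m.1 + n.1, n.2) :: p'
    else n :: ncinsert m p'
  else [:: m].

Fixpoint nccollect (p : seq ncmon) : seq ncmon :=
  if p is m :: p' then ncinsert m (nccollect p') else [::].

Fixpoint ncall0 (p : seq ncmon) : Prop :=
  if p is m :: p' then m.1 = 0 /\ ncall0 p' else True.

Lemma ncden_cat env p q : ncden env (nccat p q) = ncden env p + ncden env q.
Proof. by elim: p => [|m p IH] /=; rewrite ?add0r// IH addrA. Qed.

Lemma ncword_mul env x y w : ncword env (x ** y) w = x ** ncword env y w.
Proof. by elim: w x y => //= i w IH x y; rewrite -amulA IH. Qed.

Lemma ncword_cat env x v i w :
  ncword env x (nccat v (i :: w)) = ncword env x v ** ncword env (nth 0 env i) w.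
Proof. by elim: v x => [|j v IH] x /=; [rewrite ncword_mul|rewrite IH]. Qed.

Lemma ncden_opp env p : ncden env (ncopp p) = - ncden env p.
Proof.
by elim: p => [|m p IH] /=; rewrite ?oppr0// IH opprD /ncmoneval/= scaleNr.
Qed.

Lemma ncden_scale env k p : ncden env (ncscale k p) = k *: ncden env p.
Proof.
elim: p => [|m p IH] /=; first by rewrite scaler0.
rewrite IH /ncmoneval scalerDr /=. by rewrite scalerA.
Qed.

Lemma ncden_mulm env m p : ncden env (ncmulm m p) = ncmoneval env m ** ncden env p.
Proof.
elim: p => [|n p IH] /=; first by rewrite amul0r.
by rewrite IH amulDr /ncmoneval/= ncword_cat !amulZl !amulZr scalerA.
Qed.

Lemma ncden_mul env p q : ncden env (ncmul p q) = ncden env p ** ncden env q.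
Proof.
elim: p => [|m p IH] /=; first by rewrite amul0l.
by rewrite ncden_cat ncden_mulm IH amulDl.
Qed.

Lemma ncnormP env e : nceval env e = ncden env (ncnorm e).
Proof.
elim: e => //= [i|e1 -> e2 ->|e ->|e1 -> e2 ->|k e ->].
- by rewrite /ncmoneval scale1r addr0.
- by rewrite ncden_cat.
- by rewrite ncden_opp.
- by rewrite ncden_mul.
- by rewrite ncden_scale.
Qed.

Lemma nceqnP m n : nceqn m n -> m = n.
Proof. by elim: m n => [|m IH] [|n]//= /IH ->. Qed.

Lemma nceqwP v w : nceqw v w -> v = w.
Proof.
elim: v w => [|i v IH] [|j w]//=.
by case: ifP => // /nceqnP -> /IH ->.
Qed.

Lemma ncden_insert env m p : ncden env (ncinsert m p) = ncmoneval env m + ncden env p.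
Proof.
elim: p => [|n p IH]//; rewrite /ncinsert -/ncinsert.
case: ifP => [/nceqwP [e1 e2]|_] /=; last by rewrite IH addrCA.
by rewrite /ncmoneval/= scalerDl addrA e1 e2.
Qed.

(** The collected normal form of the difference denotes 0 once all its coefficients vanish; these
    scalar equations are the goals left by [nc_norm]. *)
Lemma ncall0P env e1 e2 :
  ncall0 (nccollect (ncnorm (NAdd e1 (NOpp e2)))) -> nceval env e1 = nceval env e2.
Proof.
move=> h; apply/eqP; rewrite -subr_eq0; apply/eqP.
rewrite -[LHS]/(nceval env (NAdd e1 (NOpp e2))) ncnormP.
have -> p : ncden env p = ncden env (nccollect p).
  by elim: p => [|m p IH]//=; rewrite ncden_insert IH.
elim: (nccollect _) h => //= m p IH [m0 /IH ->].
by rewrite /ncmoneval m0 scale0r addr0.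
Qed.

End NonCommutativeNormalization.

Ltac nc_index x env :=
  lazymatch env with
  | x :: _ => constr:(O)
  | _ :: ?env' => let n := nc_index x env' in constr:(S n)
  end.

Ltac nc_mem x env :=
  lazymatch env with
  | x :: _ => constr:(true)
  | _ :: ?env' => nc_mem x env'
  | _ => constr:(false)
  end.

(** Terms under [star] are atoms: the star has to be distributed before [nc] is called. *)
Ltac nc_atoms t env :=
  lazymatch t with
  | @GRing.add _ ?a ?b => let env := nc_atoms a env in nc_atoms b env
  | @GRing.opp _ ?a => nc_atoms a env
  | @GRing.scale _ _ _ ?a => nc_atoms a env
  | @amul _ _ ?a ?b => let env := nc_atoms a env in nc_atoms b env
  | @GRing.zero _ => env
  | _ => lazymatch nc_mem t env with
         | true => env
         | false => constr:(t :: env)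
         end
  end.

Ltac nc_reify t env :=
  lazymatch t with
  | @GRing.add _ ?a ?b =>
      let a := nc_reify a env in let b := nc_reify b env in open_constr:(NAdd a b)
  | @GRing.opp _ ?a => let a := nc_reify a env in open_constr:(NOpp a)
  | @GRing.scale _ _ ?k ?a =>
      let a := nc_reify a env in open_constr:(NScale k a)
  | @amul _ _ ?a ?b =>
      let a := nc_reify a env in let b := nc_reify b env in open_constr:(NMul a b)
  | @GRing.zero _ => open_constr:(NZero)
  | _ => let n := nc_index t env in open_constr:(NVar n)
  end.

Ltac nc_norm :=
  lazymatch goal with
  | |- @eq ?T ?a ?b =>
      let env := nc_atoms a (@nil T) in
      let env := nc_atoms b env in
      let ea := nc_reify a env in
      let eb := nc_reify b env in
      change (nceval env ea = nceval env eb)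
  end; apply: ncall0P;
  cbv [ncall0 nccollect ncinsert ncnorm ncmul ncmulm nccat ncscale ncopp nceqw
       nceqn fst snd];
  repeat split.

Ltac nc := nc_norm; first [ring | by field; rewrite ?pnatr_eq0].

(** * Real-valued norms and limits of sequences *)

Section RealNorm.
Context {R : realType}.

(** Norms take values in [R[i]], which is only partially ordered; [lra] and [nra] need them in
    [R]. *)
Definition nr (V : normedModType R[i]) (x : V) : R := complex.Re `|x|.

Section NormedModule.
Context {V : normedModType R[i]}.
Implicit Types x y : V.

Lemma nrE x : `|x| = (nr x)%:C.
Proof. by rewrite /nr RRe_real// ger0_real. Qed.

Lemma nr_ge0 x : 0 <= nr x.
Proof. by rewrite -ler0c -nrE. Qed.

Lemma nr0 : nr (0 : V) = 0.
Proof. by rewrite /nr normr0. Qed.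

Lemma nr0_eq0 x : nr x = 0 -> x = 0.
Proof. by move=> x0; apply/normr0_eq0; rewrite nrE x0. Qed.

Lemma nr_gt0 x : x != 0 -> 0 < nr x.
Proof.
by move=> x0; rewrite lt_def nr_ge0 andbT; apply: contra_neq x0; exact: nr0_eq0.
Qed.

Lemma nrN x : nr (- x) = nr x.
Proof. by rewrite /nr normrN. Qed.

Lemma nrBC x y : nr (x - y) = nr (y - x).
Proof. by rewrite -nrN opprB. Qed.

Lemma nrD x y : nr (x + y) <= nr x + nr y.
Proof. by rewrite -lecR rmorphD/= -!nrE ler_normD. Qed.

Lemma nrB x y : nr (x - y) <= nr x + nr y.
Proof. by rewrite -(nrN y) nrD. Qed.

Lemma nr_tri y x z : nr (x - z) <= nr (x - y) + nr (y - z).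
Proof. by rewrite -(subrKA y) nrD. Qed.

Lemma nr_tri0 y x : nr x <= nr (x - y) + nr y.
Proof. by have := nr_tri y x 0; rewrite !subr0. Qed.

Lemma nrZ (k : R[i]) x : nr (k *: x) = complex.Re `|k| * nr x.
Proof.
apply/complexI; rewrite -nrE normrZ rmorphM/= -nrE; congr (_ * _).
Qed.

Lemma nrZr (r : R) x : nr (r%:C *: x) = `|r| * nr x.
Proof. by rewrite nrZ normc_def/= expr0n addr0 sqrtr_sqr. Qed.

Lemma nr_half x : nr (2^-1 *: x) = 2^-1 * nr x.
Proof.
have -> : (2^-1 : R[i]) = (2^-1 : R)%:C by rewrite fmorphV rmorph_nat.
by rewrite nrZr ger0_norm ?invr_ge0.
Qed.

Lemma nr_sum (I : Type) (r : seq I) (P : pred I) (F : I -> V) :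
  nr (\sum_(i <- r | P i) F i) <= \sum_(i <- r | P i) nr (F i).
Proof.
elim/big_ind2: _ => [|x a y b xa yb|//]; first by rewrite nr0.
exact: le_trans (nrD _ _) (lerD xa yb).
Qed.

Lemma nr_small x : (forall e : R, 0 < e -> nr x <= e) -> x = 0.
Proof.
move=> h; apply/nr0_eq0/le_anti; rewrite nr_ge0 andbT.
by apply/ler_addgt0Pr => e /h; rewrite add0r.
Qed.

Definition cvs (u : nat -> V) (l : V) :=
  forall e : R, 0 < e -> exists N, forall n, (N <= n)%N -> nr (u n - l) < e.

Lemma cvs_cst x : cvs (fun=> x) x.
Proof. by move=> e e0; exists 0%N => n _; rewrite subrr nr0. Qed.

Lemma cvsD u v l m : cvs u l -> cvs v m -> cvs (fun n => u n + v n) (l + m).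
Proof.
move=> ul vm e e0; have e2 : 0 < e / 2 by rewrite divr_gt0.
have [N1 h1] := ul _ e2; have [N2 h2] := vm _ e2; exists (maxn N1 N2) => n.
rewrite geq_max => /andP[/h1 a /h2 b]; rewrite opprD addrACA.
by apply: le_lt_trans (nrD _ _) _; rewrite (splitr e) ltrD.
Qed.

Lemma cvs_bound u l x (M : R) :
  cvs u l -> (forall n, nr (u n - x) <= M) -> nr (l - x) <= M.
Proof.
move=> ul uM; apply/ler_addgt0Pr => e /ul [N /(_ N (leqnn _))] h.
rewrite (le_trans (nr_tri (u N) _ _))// addrC lerD// nrBC; exact: ltW.
Qed.

Lemma cvs_uniq u l m : cvs u l -> cvs u m -> l = m.
Proof.
move=> ul um; apply/eqP; rewrite -subr_eq0; apply/eqP/nr_small => e e0.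
have e2 : 0 < e / 2 by rewrite divr_gt0.
have [N1 h1] := ul _ e2; have [N2 h2] := um _ e2.
have := h1 _ (leq_maxl N1 N2); have := h2 _ (leq_maxr N1 N2).
have := nr_tri (u (maxn N1 N2)) l m; rewrite (nrBC l (u _)); lra.
Qed.

Lemma cvs_shift u l : cvs u l -> cvs (fun n => u n.+1) l.
Proof. by move=> ul e /ul [N h]; exists N => n Nn; apply: h; exact: leqW. Qed.

Lemma eq_cvs u v l : (exists N, forall n, (N <= n)%N -> u n = v n) ->
  cvs u l -> cvs v l.
Proof.
move=> [N uv] ul e /ul [N' h]; exists (maxn N N') => n.
by rewrite geq_max => /andP[/uv <- /h].
Qed.

End NormedModule.

Lemma cvs_lip (V W : normedModType R[i]) (M : R) (f : W -> V) u (l : W) :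
  (forall x y : W, nr (f x - f y) <= M * nr (x - y)) ->
  cvs u l -> cvs (f \o u) (f l).
Proof.
move=> fM ul e e0; have M0 : 0 < `|M| + 1 by rewrite ltr_wpDl.
have [N hN] := ul _ (divr_gt0 e0 M0).
exists N => n /hN; rewrite ltr_pdivlMr// => h; apply: le_lt_trans (fM _ _) _.
apply: le_lt_trans h; have := nr_ge0 (u n - l); have := ler_norm M; nra.
Qed.

Lemma nr_complete (V : completeNormedModType R[i]) (u : nat -> V) :
  (forall e : R, 0 < e ->
    exists N, forall m n, (N <= m)%N -> (N <= n)%N -> nr (u m - u n) < e) ->
  exists l, cvs u l.
Proof.
move=> uC; have cu : cvg (u @ \oo).
  apply/cauchy_cvgP/cauchy_exP => e e0.
  have er : e = (complex.Re e)%:C by rewrite RRe_real// gtr0_real.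
  have e0' : 0 < complex.Re e by rewrite -ltcR -er.
  have [N hN] := uC _ e0'; exists (u N), N => // n /= Nn.
  by rewrite -ball_normE/= er nrE ltcR hN.
exists (lim (u @ \oo)) => e e0.
have e0' : 0 < e%:C by rewrite ltcR.
have /cvgr_distC_lt/(_ _ e0') [N _ hN] := cu.
by exists N => n /hN/=; rewrite nrE ltcR.
Qed.

(** The increments of [t] dominate norms, so [t] is nondecreasing; being bounded it is Cauchy, and
    [u] inherits this. *)
Lemma cvs_majorant (V : completeNormedModType R[i]) (u : nat -> V)
    (t : nat -> R) (M : R) :
  (forall n, nr (u n.+1 - u n) <= t n.+1 - t n) -> (forall n, t n <= M) ->
  exists l, cvs u l.
Proof.
move=> ut tM; apply: nr_complete => e e0.
have tinc : {homo t : m n / (m <= n)%N >-> m <= n}.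
  apply: homo_leq => [//|? ? ?|n]; first exact: le_trans.
  by rewrite -subr_ge0 (le_trans (nr_ge0 _) (ut n)).
have ud m k : nr (u (m + k)%N - u m) <= t (m + k)%N - t m.
  elim: k => [|k IH]; first by rewrite addn0 !subrr nr0.
  rewrite addnS; have := nr_tri (u (m + k)%N) (u (m + k).+1) (u m).
  by have := ut (m + k)%N; lra.
have [N tN] : exists N, forall n, (N <= n)%N -> t n - t N < e / 2.
  apply: contrapT => /forallNP h.
  have {}h N : exists n, t N + e / 2 <= t n.
    by have /existsNP[n /not_implyP[Nn /negP]] := h N; rewrite -leNgt => ?; exists n; lra.
  have hk k : exists n, t 0%N + k%:R * (e / 2) <= t n.
    elim: k => [|k [n hn]]; first by exists 0%N; rewrite mul0r addr0.
    by have [n' hn'] := h n; exists n'; rewrite -natr1; lra.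
  have [k hk'] : exists k, (M - t 0%N) / (e / 2) < k%:R.
    exists (Num.bound `|(M - t 0%N) / (e / 2)|).
    exact: le_lt_trans (ler_norm _) (archi_boundP _).
  have [n] := hk k; have := tM n; move: hk'; rewrite ltr_pdivrMr; lra.
exists N => m n Nm Nn.
have := ud N (m - N)%N; have := ud N (n - N)%N; rewrite !subnKC//.
have := tN _ Nm; have := tN _ Nn; have := nr_tri (u N) (u m) (u n).
rewrite (nrBC (u N)); lra.
Qed.

(* Removes constants in norm estimates obtained for iterated squares. *)
Lemma root_bound (a b C D : R) : 0 <= a -> 0 <= b ->
  (forall k, a ^+ (2 ^ k) <= (C + D * (2 ^ k)%:R) * b ^+ (2 ^ k)) -> a <= b.
Proof.
move=> a0 b0 h; rewrite leNgt; apply/negP => ba.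
have [bz|bn0] := eqVneq b 0.
  by have := h 0%N; rewrite expn0 !expr1 bz mulr0 => h0; lra.
have bp : 0 < b by rewrite lt_def bn0 b0.
pose d := a / b - 1; have d0 : 0 < d by rewrite /d subr_gt0 ltr_pdivlMr// mul1r.
have ad : a = (1 + d) * b by rewrite /d addrC subrK divfK.
have {}h k : (1 + d) ^+ (2 ^ k) <= C + D * (2 ^ k)%:R.
  by have := h k; rewrite ad exprMn ler_pM2r// exprn_gt0.
(* Bernoulli's inequality for the exponent N = 2^k, squared, gives at least N^2 d^2 for the exponent
   2 N. This exceeds C + 2 D N as soon as N is larger than (|C| + 2 |D|) / d^2. *)
have bern m : 1 + m%:R * d <= (1 + d) ^+ m.
  elim: m => [|m IH]; first by rewrite mul0r addr0 expr0.
  rewrite exprS -natr1; have : 0 <= m%:R * d * d by rewrite !mulr_ge0// ltW.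
  by nra.
have [k hk] : exists k, (`|C| + 2 * `|D|) / d ^+ 2 < (2 ^ k)%:R.
  exists (Num.bound `|(`|C| + 2 * `|D|) / d ^+ 2|).
  apply: le_lt_trans (ler_norm _) _; apply: lt_trans (archi_boundP _) _ => //.
  by rewrite ltr_nat ltn_expl.
have := h k.+1; rewrite expnS mulnC exprM => {}h.
have : (1 + (2 ^ k)%:R * d) ^+ 2 <= ((1 + d) ^+ (2 ^ k)) ^+ 2.
  have d1 := ltW d0; apply: lerXn2r; last exact: bern.
    by rewrite nnegrE addr_ge0// mulr_ge0.
  by rewrite nnegrE exprn_ge0// addr_ge0.
have n1 : 1 <= (2 ^ k)%:R :> R by rewrite ler1n expn_gt0.
move: hk; rewrite ltr_pdivrMr ?exprn_gt0// => hk.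
have := ler_norm C; have := ler_norm D; move: h; rewrite natrM.
move: n1 hk; set N : R := (2 ^ k)%:R; set X := _ ^+ (2 ^ k).
have C0 := normr_ge0 C; have D0 := normr_ge0 D.
move: C0 D0; set c := `|C|; set e := `|D| => C0 D0 N1 hk h hD hC hX.
have N0 : 0 < N by lra.
have k1 : (c + 2 * e) * N < N * d ^+ 2 * N by rewrite ltr_pM2r.
have k2 : c <= c * N by rewrite ler_peMr.
have k3 : D * (N * 2) <= e * (N * 2) by rewrite ler_wpM2r// mulr_ge0// ltW.
have k4 : 0 <= N * d by rewrite mulr_ge0// ltW.
by move: hX; rewrite sqrrD expr1n mul1r exprMn; lra.
Qed.

Section Cstar.
Context {A : cstarAlgType R[i]}.
Implicit Types x y : A.

Lemma nrM x y : nr (x ** y) <= nr x * nr y.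
Proof. by rewrite -lecR rmorphM/= -!nrE norm_amul. Qed.

Lemma nrM3 x y z : nr (x ** y ** z) <= nr x * nr y * nr z.
Proof. by rewrite (le_trans (nrM _ _))// ler_wpM2r ?nr_ge0 ?nrM. Qed.

Lemma nrM_le x y (a b : R) : nr x <= a -> nr y <= b -> nr (x ** y) <= a * b.
Proof. by move=> xa yb; rewrite (le_trans (nrM _ _))// ler_pM ?nr_ge0. Qed.

Lemma nr_star x : nr (star x) = nr x.
Proof. by rewrite /nr norm_star. Qed.

Lemma nr_starM x : nr (star x ** x) = nr x ^+ 2.
Proof. by apply/complexI; rewrite rmorphXn/= -!nrE norm_star_amul. Qed.

Lemma nr_Mstar x : nr (x ** star x) = nr x ^+ 2.
Proof. by have := nr_starM (star x); rewrite starK nr_star. Qed.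

Lemma nr_sa x : star x = x -> nr (x ** x) = nr x ^+ 2.
Proof. by move=> xs; rewrite -nr_starM xs. Qed.

Lemma amulNr x y : x ** (- y) = - (x ** y).
Proof. by nc. Qed.

Lemma starM0 x : star x ** x = 0 -> x = 0.
Proof.
move=> h; apply: nr0_eq0; apply/eqP.
by rewrite -(sqrf_eq0 (nr x)) -nr_starM h nr0.
Qed.

Lemma nr_proj_le1 (p : A) : projection p -> nr p <= 1.
Proof.
move=> [ps pp]; have := nr_sa ps; rewrite pp => h; have := nr_ge0 p; nra.
Qed.

Lemma nr_proj (p : A) : projection p -> p != 0 -> nr p = 1.
Proof.
move=> [ps pp] /nr_gt0 p0; have := nr_sa ps; rewrite pp expr2 => h.
by apply: (mulfI (lt0r_neq0 p0)); rewrite -h mulr1.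
Qed.

Lemma star0 : star (0 : A) = 0.
Proof. by have := starB (0 : A) 0; rewrite subrr => ->; rewrite subrr. Qed.

Lemma starN x : star (- x) = - star x.
Proof. by rewrite -sub0r starB star0 sub0r. Qed.

Lemma star_sum (I : Type) (r : seq I) (P : pred I) (F : I -> A) :
  star (\sum_(i <- r | P i) F i) = \sum_(i <- r | P i) star (F i).
Proof. by elim/big_rec2: _ => [|i x y _ <-]; rewrite ?star0// starD. Qed.

Lemma amul_suml (I : Type) (r : seq I) (P : pred I) (F : I -> A) x :
  (\sum_(i <- r | P i) F i) ** x = \sum_(i <- r | P i) F i ** x.
Proof. by elim/big_rec2: _ => [|i a y _ <-]; rewrite ?amul0l// amulDl. Qed.

Lemma amul_sumr (I : Type) (r : seq I) (P : pred I) (F : I -> A) x :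
  x ** (\sum_(i <- r | P i) F i) = \sum_(i <- r | P i) x ** F i.
Proof. by elim/big_rec2: _ => [|i a y _ <-]; rewrite ?amul0r// amulDr. Qed.

Lemma starZr (r : R) x : star (r%:C *: x) = r%:C *: star x.
Proof. by rewrite starZ; congr (_ *: _); apply/conj_Creal; rewrite complex_real. Qed.

Lemma star_half x : star (2^-1 *: x) = 2^-1 *: star x.
Proof. by rewrite starZ fmorphV rmorph_nat. Qed.

Lemma starZi x : star ('i *: x) = - ('i *: star x).
Proof. by rewrite starZ conjCi scaleNr. Qed.

Lemma cvsM (u v : nat -> A) l m :
  cvs u l -> cvs v m -> cvs (fun n => u n ** v n) (l ** m).
Proof.
move=> ul vm.
have [N1 h1] := vm _ ltr01.
have vb n : (N1 <= n)%N -> nr (v n) <= nr m + 1.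
  by move=> /h1 h; have := nr_tri0 m (v n); lra.
move=> e e0; have M0 : 0 < nr m + 1 + nr l by have := nr_ge0 m; have := nr_ge0 l; lra.
have d0 := divr_gt0 e0 M0.
have [N2 h2] := ul _ d0; have [N3 h3] := vm _ d0.
exists (maxn N1 (maxn N2 N3)) => n; rewrite !geq_max => /and3P[a b c].
have -> : u n ** v n - l ** m = (u n - l) ** v n + l ** (v n - m) by nc.
apply: le_lt_trans (nrD _ _) _.
have := nrM (u n - l) (v n); have := nrM l (v n - m).
have := vb _ a; have := h2 _ b; have := h3 _ c.
move: d0; set d := e / _ => d0.
have -> : e = d * (nr m + 1 + nr l) by rewrite /d divfK// gt_eqF.
have := nr_ge0 l; have := nr_ge0 (u n - l); have := nr_ge0 (v n).
move=> *.
have : nr (u n - l) * nr (v n) < d * (nr m + 1).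
  apply: (@le_lt_trans _ _ (nr (u n - l) * (nr m + 1))); first exact: ler_wpM2l.
  by rewrite ltr_pM2r//; have := nr_ge0 m; lra.
have : nr l * nr (v n - m) <= nr l * d by rewrite ler_wpM2l// ltW.
nra.
Qed.

Lemma cvsMl x (v : nat -> A) m : cvs v m -> cvs (fun n => x ** v n) (x ** m).
Proof. by move=> h; apply: cvsM => //; exact: cvs_cst. Qed.

Lemma cvsMr x (v : nat -> A) m : cvs v m -> cvs (fun n => v n ** x) (m ** x).
Proof. by move=> h; apply: cvsM => //; exact: cvs_cst. Qed.

Lemma cvsZ k (v : nat -> A) m : cvs v m -> cvs (fun n => k *: v n) (k *: m).
Proof.
by apply: (cvs_lip (M := complex.Re `|k|)) => x y; rewrite -scalerBr nrZ.
Qed.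

Lemma cvs_star (v : nat -> A) m : cvs v m -> cvs (fun n => star (v n)) (star m).
Proof.
by apply: (cvs_lip (M := 1)) => x y; rewrite -starB nr_star mul1r.
Qed.

End Cstar.
End RealNorm.

(** * Square roots and commuting squares *)

Section SquareRoots.
Context {R : realType} {A : cstarAlgType R[i]}.
Implicit Types (x y z t g l : A).

(* The iteration y := (t + y^2) / 2 converges for |t| <= 1, as its increments
   are bounded by those of the same iteration for the real number |t|. *)
Lemma sqrt_one_minus t : star t = t -> nr t <= 1 ->
  exists y, [/\ star y = y, y + y = t + y ** y, nr y <= nr t
    & forall z, z ** t = t ** z -> z ** y = y ** z].
Proof.
move=> ts t1.
(* The relation [y + y = t + y ** y] says (1 - y)^2 = 1 - t without mentioning a unit. *)
pose u := fix u n := if n is n'.+1 then 2^-1 *: (t + u n' ** u n') else 0 : A.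
pose r := fix r n := if n is n'.+1 then (nr t + r n' * r n') / 2 else 0 : R.
have t0 := nr_ge0 t.
have r0 n : 0 <= r n by elim: n => //= n IH; have := mulr_ge0 IH IH; lra.
have rt n : r n <= nr t.
  elim: n => //= n IH; have : r n * r n <= nr t * 1.
    by rewrite ler_pM// (le_trans IH).
  lra.
have ur n : nr (u n) <= r n.
  elim: n => [|n IH] /=; first by rewrite nr0.
  rewrite nr_half; have := nrM_le IH IH; have := nrD t (u n ** u n); lra.
have ud n : nr (u n.+1 - u n) <= r n.+1 - r n.
  elim: n => [|n IH].
    by rewrite /= amul0l !subr0 addr0 nr_half; lra.
  have -> : u n.+2 - u n.+1 =
      2^-1 *: ((u n.+1 - u n) ** u n.+1 + u n ** (u n.+1 - u n)).
    transitivity (2^-1 *: (t + u n.+1 ** u n.+1) - 2^-1 *: (t + u n ** u n)).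
      by [].
    by nc.
  rewrite nr_half; have := nrM_le IH (ur n.+1); have := nrM_le (ur n) IH.
  have := nrD ((u n.+1 - u n) ** u n.+1) (u n ** (u n.+1 - u n)).
  have -> : r n.+2 - r n.+1 =
      ((r n.+1 - r n) * r n.+1 + r n * (r n.+1 - r n)) / 2.
    rewrite [r n.+2]/=; set a := r n.+1; have -> : a = (nr t + r n * r n) / 2 by [].
    lra.
  lra.
have [y uy] := cvs_majorant ud rt.
exists y; split.
- apply: cvs_uniq (cvs_star uy) _; apply: eq_cvs uy; exists 0%N => n _.
  elim: n => [|n IH] /=; first by rewrite star0.
  by rewrite star_half starD ts starM -!IH.
- have uy1 := cvs_shift uy.
  apply: cvs_uniq (cvsD uy1 uy1) _.
  apply: (eq_cvs (u := fun n => t + u n ** u n)).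
    by exists 0%N => n _; rewrite [u n.+1]/=; nc.
  exact: cvsD (cvs_cst t) (cvsM uy uy).
- rewrite -[y]subr0; apply: cvs_bound uy _ => n.
  by rewrite subr0 (le_trans (ur n)).
move=> z zt; apply: cvs_uniq (cvsMl z uy) _; apply: eq_cvs (cvsMr z uy).
exists 0%N => n _; elim: n => [|n IH] /=; first by rewrite amul0l amul0r.
rewrite amulZl amulZr amulDl amulDr zt; congr (_ *: (_ + _)).
by rewrite -amulA IH !amulA IH.
Qed.

(** Taking norms gives 2 |d| <= |d|. With d = e y - y this shows that the root from [sqrt_one_minus]
    stays in the corner with unit e. *)
Lemma addrr_mul_eq0 (d y : A) : d + d = d ** y -> nr y <= 1 -> d = 0.
Proof.
move=> dd y1; apply: nr0_eq0; apply/le_anti; rewrite nr_ge0 andbT.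
have := nrM_le (lexx (nr d)) y1; rewrite -dd.
have -> : d + d = (2 : R)%:C *: d by rewrite rmorph_nat; nc.
rewrite nrZr ger0_norm//; lra.
Qed.

(** For the normal element u = g + i l, u^* u is g^2 + l^2 and the real part of u^2 is g^2 - l^2,
    while |u^2| <= |u|^2. *)
Lemma nr_commuting_sqs g l : star g = g -> star l = l -> g ** l = l ** g ->
  nr (g ** g - l ** l) <= nr (g ** g + l ** l).
Proof.
move=> gs ls gl; pose j := 'i *: l.
have js : star j = - j by rewrite /j starZi ls.
have gj : g ** j = j ** g by rewrite /j amulZl amulZr gl.
have jj : j ** j = - (l ** l).
  by rewrite /j amulZl amulZr scalerA mulCii scaleN1r.
have uu : star (g + j) ** (g + j) = g ** g + l ** l.
  rewrite starD gs js; transitivity (g ** g - j ** j + (g ** j - j ** g)).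
    by nc.
  by rewrite gj subrr addr0 jj opprK.
have -> : g ** g - l ** l =
    2^-1 *: ((g + j) ** (g + j) + star (g + j) ** star (g + j)).
  by rewrite -jj starD gs js; nc.
rewrite nr_half -uu nr_starM.
have := nrM (g + j) (g + j); have := nrM (star (g + j)) (star (g + j)).
have := nrD ((g + j) ** (g + j)) (star (g + j) ** star (g + j)).
rewrite !nr_star expr2; lra.
Qed.

(** Half the difference of g^2 + l^2 and g^2 - l^2 is l^2. This replaces monotonicity of the norm on
    positive elements. *)
Lemma nr_commuting_sq_le g l : star g = g -> star l = l -> g ** l = l ** g ->
  nr (l ** l) <= nr (g ** g + l ** l).
Proof.
move=> gs ls gl; have := nr_commuting_sqs gs ls gl.
have -> : l ** l = 2^-1 *: ((g ** g + l ** l) - (g ** g - l ** l)).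
  by nc.
rewrite nr_half; set a := (X in _ -> 2^-1 * nr X <= _).
(* The rewriting of [l ** l] also hit the sum and the difference of squares; they are restored
   here. *)
have -> : g ** g - 2^-1 *: a = g ** g - l ** l by rewrite /a; nc.
have -> : g ** g + 2^-1 *: a = g ** g + l ** l by rewrite /a; nc.
have := nrB (g ** g + l ** l) (g ** g - l ** l); rewrite -/a; lra.
Qed.

End SquareRoots.

(** * Positivity in the corner of a projection *)

Section Corner.
Context {R : realType} {A : cstarAlgType R[i]}.
Variable e : A.
Hypothesis e_proj : projection e.
Implicit Types (x y z g h : A) (r s : R).

Definition in_corner x := e ** x = x /\ x ** e = x.

Lemma in_cornerD x y : in_corner x -> in_corner y -> in_corner (x + y).
Proof. by move=> [a b] [c d]; split; rewrite (amulDl, amulDr) (a, b) (c, d). Qed.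

Lemma in_cornerZ k x : in_corner x -> in_corner (k *: x).
Proof. by move=> [a b]; split; rewrite (amulZl, amulZr) (a, b). Qed.

Lemma in_cornerN x : in_corner x -> in_corner (- x).
Proof. by rewrite -scaleN1r; exact: in_cornerZ. Qed.

Lemma in_cornerB x y : in_corner x -> in_corner y -> in_corner (x - y).
Proof. by move=> cx cy; apply: in_cornerD => //; exact: in_cornerN. Qed.

Lemma in_cornerM x y : in_corner x -> in_corner y -> in_corner (x ** y).
Proof. by move=> [a _] [_ d]; split; rewrite (=^~ amulA, amulA) (a, d). Qed.

Lemma in_corner_star x : in_corner x -> in_corner (star x).
Proof.
by case: e_proj => es _ [a b]; split; rewrite -{1}es -starM (a, b).
Qed.

Lemma in_corner_unit : in_corner e.
Proof. by case: e_proj => _ ee; split. Qed.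

Lemma in_cornerC x : in_corner x -> e ** x = x ** e.
Proof. by move=> [-> ->]. Qed.

(** In the corner with unit [e] this says that the spectrum of [h] lies in [0, 2 r]. Positivity is
    thus a norm inequality, and radii add up under sums. *)
Definition posc r h :=
  [/\ star h = h, in_corner h, 0 < r & nr (r%:C *: e - h) <= r].

Let nr_e : nr e <= 1. Proof. exact: nr_proj_le1. Qed.

Lemma nr_scaled_unit r : 0 <= r -> nr (r%:C *: e) <= r.
Proof. by move=> r0; rewrite nrZr ger0_norm// ler_piMr. Qed.

(** The element t = e - r^-2 h has norm at most 1, so [sqrt_one_minus] gives y with (e - y)^2 = e -
    t; the root is r (e - y). *)
Lemma posc_sqrt r h : posc (r ^+ 2) h -> 0 < r ->
  exists g, [/\ posc r g, g ** g = h
    & forall z, in_corner z -> z ** h = h ** z -> z ** g = g ** z].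
Proof.
move=> [hs hc _ hr] r0; have [es ee] := e_proj.
have r20 : 0 < r ^+ 2 by rewrite exprn_gt0.
have rn0 : r != 0 by rewrite gt_eqF.
pose t := (r ^- 2)%:C *: ((r ^+ 2)%:C *: e - h).
have tE : t = e - (r ^- 2)%:C *: h.
  by rewrite /t scalerBr scalerA -rmorphM/= mulVf ?sqrf_eq0// scale1r.
have tc : in_corner t.
  by rewrite tE; apply: in_cornerB; [exact: in_corner_unit|exact: in_cornerZ].
have ts : star t = t by rewrite tE starB starZr hs es.
have t1 : nr t <= 1.
  rewrite /t nrZr ger0_norm; last by rewrite invr_ge0 ltW.
  by rewrite mulrC ler_pdivrMr// mul1r.
have [y [ys yy yt yC]] := sqrt_one_minus ts t1.
have y1 := le_trans yt t1.
have ye : e ** y = y ** e by apply: yC; case: tc => -> ->.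
have ety : e ** t = t by case: tc.
have ey : e ** y = y.
  apply/eqP; rewrite -subr_eq0; apply/eqP.
  apply: (addrr_mul_eq0 (y := y)) => //.
  transitivity (e ** (y + y) - (y + y)); first by nc.
  by rewrite yy amulDr ety; nc.
have yc : in_corner y by split=> //; rewrite -ye.
exists (r%:C *: (e - y)); split.
- split=> //.
  + by rewrite starZr starB es ys.
  + by apply: in_cornerZ; apply: in_cornerB => //; exact: in_corner_unit.
  + rewrite scalerBr opprB addrC subrK nrZr ger0_norm ?(ltW r0)//.
    by rewrite ler_piMr ?(ltW r0).
- transitivity ((r ^+ 2)%:C *: (e ** e - e ** y - y ** e + y ** y)).
    by rewrite rmorphXn/=; nc.
  rewrite -ye ee ey; have -> : e - y - y + y ** y = e - t.
    have -> : t = y + y - y ** y by rewrite yy addrK.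
    by nc.
  by rewrite tE opprB addrCA subrr addr0 scalerA -rmorphM/= mulfV ?scale1r// sqrf_eq0.
- move=> z zc zh; rewrite amulZr amulZl amulBr amulBl (in_cornerC zc) yC//.
  by rewrite tE amulBr amulBl (in_cornerC zc) amulZr amulZl zh.
Qed.

(** After scaling to b = a / r of norm at most 1, e - b^2 is itself a square (e - y)^2 that commutes
    with b, and b^2 + (e - y)^2 = e. Then [nr_commuting_sq_le] bounds |e - b^2| by |e|. *)
Lemma posc_sq r a : star a = a -> in_corner a -> 0 < r -> nr a <= r ->
  posc (r ^+ 2) (a ** a).
Proof.
move=> sa ac r0 ar; have [es ee] := e_proj.
have rn0 : r != 0 by rewrite gt_eqF.
split; [by rewrite starM sa|exact: in_cornerM|by rewrite exprn_gt0|].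
pose b := r^-1%:C *: a.
have ab : a = r%:C *: b by rewrite /b scalerA -rmorphM/= mulfV// scale1r.
have bs : star b = b by rewrite starZr sa.
have bc : in_corner b by exact: in_cornerZ.
have b1 : nr b <= 1.
  rewrite /b nrZr ger0_norm; last by rewrite invr_ge0 ltW.
  by rewrite mulrC ler_pdivrMr// mul1r.
have tc := in_cornerM bc bc.
have ts : star (b ** b) = b ** b by rewrite starM bs.
have [|y [ys yy yt yC]] := sqrt_one_minus ts.
  by have := nrM_le b1 b1; rewrite mulr1.
have -> : (r ^+ 2)%:C *: e - a ** a = (r ^+ 2)%:C *: (e - b ** b).
  by rewrite ab rmorphXn/=; nc.
have r20 : 0 <= r ^+ 2 by rewrite exprn_ge0 ?(ltW r0).
rewrite nrZr ger0_norm// ler_piMr//.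
have ye : e ** y = y ** e by apply: yC; case: tc => -> ->.
have ey : e ** y = y.
  apply/eqP; rewrite -subr_eq0; apply/eqP.
  apply: (addrr_mul_eq0 (y := y)); last first.
    by rewrite (le_trans yt)//; have := nrM_le b1 b1; rewrite mulr1.
  transitivity (e ** (y + y) - (y + y)); first by nc.
  by rewrite yy amulDr (proj1 tc); nc.
have gg : (e - y) ** (e - y) = e - b ** b.
  transitivity (e ** e - e ** y - y ** e + y ** y); first by nc.
  have -> : b ** b = y + y - y ** y by rewrite yy addrK.
  by rewrite -ye ee ey; nc.
have := @nr_commuting_sq_le _ _ b (e - y); rewrite gg (addrC (b ** b)) subrK => h.
apply: le_trans nr_e; apply: h => //; first by rewrite starB es ys.
by rewrite amulBr amulBl (in_cornerC bc) -yC// !amulA.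
Qed.

Lemma poscD r s h k : posc r h -> posc s k -> posc (r + s) (h + k).
Proof.
move=> [hs hc r0 hr] [ks kc s0 kr]; split; rewrite ?starD ?hs ?ks ?addr_gt0//.
  exact: in_cornerD.
have -> : (r + s)%:C *: e - (h + k) = (r%:C *: e - h) + (s%:C *: e - k).
  by rewrite rmorphD/=; nc.
by rewrite (le_trans (nrD _ _))// lerD.
Qed.

Lemma posc_sqr_root r h : posc r h -> exists2 s, 0 < s & r = s ^+ 2.
Proof.
by move=> [_ _ r0 _]; exists (Num.sqrt r); rewrite ?sqrtr_gt0// sqr_sqrtr// ltW.
Qed.

(** The roots f of h and g of t e - h commute, and f^2 + g^2 = t e. *)
Lemma posc_le r s t h : posc r h -> posc s (t%:C *: e - h) -> 0 <= t ->
  nr h <= t.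
Proof.
move=> hp kp t0; have [r' r'0 rE] := posc_sqr_root hp.
have [s' s'0 sE] := posc_sqr_root kp.
rewrite rE in hp; rewrite sE in kp.
have [f [[fs fc _ _] ff fC]] := posc_sqrt hp r'0.
have [g [[gs gc _ _] gg gC]] := posc_sqrt kp s'0.
rewrite -ff; have := @nr_commuting_sq_le _ _ g f gs fs.
rewrite ff gg subrK => h1; apply: le_trans (h1 _) (nr_scaled_unit t0).
apply/esym/gC => //; rewrite amulBr amulBl amulZl amulZr (in_cornerC fc).
by rewrite -ff amulA.
Qed.

Lemma posc_anti r s h : posc r h -> posc s (- h) -> h = 0.
Proof.
move=> hp hn; apply: nr0_eq0; apply/le_anti; rewrite nr_ge0 andbT.
by apply: posc_le hp _ (lexx 0); rewrite scale0r sub0r; exact: hn.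
Qed.

Fixpoint apow x n := if n is n'.+1 then apow x n' ** x else e.

Lemma apow_corner x n : in_corner x -> in_corner (apow x n).
Proof.
move=> xc; elim: n => [|n IH] /=; first exact: in_corner_unit.
exact: in_cornerM.
Qed.

Lemma apowD x m n : in_corner x -> apow x (m + n)%N = apow x m ** apow x n.
Proof.
move=> xc; elim: n => [|n IH] /=.
  by rewrite addn0; case: (apow_corner m xc).
by rewrite addnS/= IH amulA.
Qed.

Lemma nr_apow x n r : in_corner x -> nr x <= r -> nr (apow x n) <= r ^+ n.
Proof.
by move=> xc xr; elim: n => [|n IH] //=; rewrite exprSr nrM_le.
Qed.

Lemma nr_apow_sa x k : in_corner x -> star x = x ->
  nr (apow x (2 ^ k)) = nr x ^+ (2 ^ k).
Proof.
move=> xc xs.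
have ps n : star (apow x n) = apow x n.
  elim: n => [|n IH]; first by case: e_proj.
  by rewrite [LHS]/= starM IH xs; have := apowD 1 n xc; rewrite add1n /= (proj1 xc).
elim: k => [|k IH]; first by rewrite /= (proj1 xc) expr1.
by rewrite expnS mul2n -addnn apowD// nr_sa// IH exprD expr2.
Qed.

(* The substitute for the equality of the nonzero spectra of y^* y and y y^*:
   powers of r + y^* y and r + y y^* grow at comparable rates. *)
Lemma nr_star_swap y r : in_corner y -> 0 < r ->
  nr (r%:C *: e + star y ** y) <= r -> nr (r%:C *: e + y ** star y) <= r.
Proof.
move=> yc r0; have [es ee] := e_proj.
have [yc1 yc2] := in_corner_star yc; have [ye1 ye2] := yc.
set q := _ + star y ** y; set q' := _ + y ** star y => qr.
have qc : in_corner q.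
  apply: in_cornerD; first by apply: in_cornerZ; exact: in_corner_unit.
  by apply: in_cornerM => //; exact: in_corner_star.
have qc' : in_corner q'.
  apply: in_cornerD; first by apply: in_cornerZ; exact: in_corner_unit.
  by apply: in_cornerM => //; exact: in_corner_star.
have qs' : star q' = q' by rewrite starD starZr es starM starK.
have yq : y ** q = q' ** y.
  by rewrite amulDr amulDl amulZr amulZl ye1 ye2 amulA.
have yp n : y ** apow q n = apow q' n ** y.
  elim: n => [|n IH] /=; first by rewrite ye1 ye2.
  by rewrite amulA IH -amulA yq amulA.
have pn n : r * nr (apow q' n) <= (r + nr y ^+ 2 * n%:R) * r ^+ n.
  elim: n => [|n IH].
    by rewrite /= mulr0 addr0 expr0 ler_wpM2l// ltW.
  have -> : apow q' n.+1 = r%:C *: apow q' n + y ** apow q n ** star y.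
    rewrite /= {2}/q' amulDr amulZr amulA yp.
    by case: (apow_corner n qc') => _ ->.
  have h1 := nrM3 y (apow q n) (star y).
  have h2 := nr_apow n qc qr.
  have h3 := nrD (r%:C *: apow q' n) (y ** apow q n ** star y).
  have h6 : nr (r%:C *: apow q' n) = r * nr (apow q' n).
    by rewrite nrZr ger0_norm// ltW.
  rewrite nr_star in h1; rewrite h6 in h3.
  have h4 : nr y * nr (apow q n) * nr y <= nr y ^+ 2 * r ^+ n.
    by rewrite mulrAC -expr2 ler_wpM2l// exprn_ge0// nr_ge0.
  have h5 : nr (r%:C *: apow q' n + y ** apow q n ** star y) <=
      r * nr (apow q' n) + nr y ^+ 2 * r ^+ n by lra.
  have -> : (r + nr y ^+ 2 * n.+1%:R) * r ^+ n.+1 =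
     r * ((r + nr y ^+ 2 * n%:R) * r ^+ n + nr y ^+ 2 * r ^+ n).
    by rewrite (exprS r n) -(natr1 n); ring.
  by rewrite ler_pM2l// (le_trans h5)// lerD2r.
(* The constants come from dividing [pn] by r. *)
apply: (@root_bound _ _ _ 1 (nr y ^+ 2 / r)) => [||k]; rewrite ?nr_ge0 ?(ltW r0)//.
rewrite -nr_apow_sa// -(ler_pM2l r0) (le_trans (pn _))//.
rewrite le_eqVlt; apply/orP/or_introl/eqP.
by field; rewrite gt_eqF.
Qed.

(* Kaplansky's argument: y y^* = (y y^* + y^* y) + c^2 is positive,
   and -y y^* is positive because -y^* y is. *)
Lemma starM_eq_neg_sq y c : in_corner y -> star c = c -> in_corner c ->
  star y ** y = - (c ** c) -> y = 0.
Proof.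
move=> yc cs cc yE.
have r0 : 0 < nr c + 1 by have := nr_ge0 c; lra.
have /(posc_sq cs cc r0) cp : nr c <= nr c + 1 by rewrite lerDl.
have r20 : 0 < (nr c + 1) ^+ 2 by rewrite exprn_gt0.
have yc' := in_corner_star yc.
have np : posc ((nr c + 1) ^+ 2) (- (y ** star y)).
  split=> //; first by rewrite starN starM starK.
    by apply: in_cornerN; exact: in_cornerM.
  by rewrite opprK; apply: nr_star_swap => //; rewrite yE; case: cp.
(* Up to sign, twice the real and imaginary parts of y; hence a^2 + b^2 = 2 (y y^* + y^* y). *)
pose a := y + star y; pose b := 'i *: (y - star y).
have as_ : star a = a by rewrite starD starK addrC.
have bs : star b = b.
  by rewrite starZi starB starK -scalerN opprB.
have ac : in_corner a by exact: in_cornerD.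
have bc : in_corner b by apply: in_cornerZ; exact: in_cornerB.
have bb : b ** b = - ((y - star y) ** (y - star y)).
  by rewrite /b amulZl amulZr scalerA mulCii scaleN1r.
have s0 : 0 < nr a + nr b + nr c + 1.
  by have := nr_ge0 a; have := nr_ge0 b; have := nr_ge0 c; lra.
have ap := posc_sq as_ ac s0; have bp := posc_sq bs bc s0.
have dp := posc_sq cs cc s0.
have {ap}ap := ap ltac:(have := nr_ge0 b; have := nr_ge0 c; lra).
have {bp}bp := bp ltac:(have := nr_ge0 a; have := nr_ge0 c; lra).
have {dp}dp := dp ltac:(have := nr_ge0 b; have := nr_ge0 a; lra).
have := poscD (poscD ap bp) (poscD dp dp).
have -> : a ** a + b ** b + (c ** c + c ** c) = y ** star y + y ** star y.
  rewrite bb -[c ** c]opprK -yE /a; nc.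
move=> pp; have := posc_anti pp; rewrite opprD => /(_ _ (poscD np np)) h.
apply: nr0_eq0; apply/eqP; rewrite -(sqrf_eq0 (nr y)) -nr_Mstar; apply/eqP.
have -> : y ** star y = 2^-1 *: (y ** star y + y ** star y) by nc.
by rewrite h scaler0 nr0.
Qed.

(** Let k be the root of h^2, l the root of k, and m = k - h, twice the negative part of h. Since h
    m = - k m, the element y = x m satisfies y^* y = - (l m)^2, so x m = 0 by [starM_eq_neg_sq].
    Then h m and k m vanish, hence m^2 = 0 and x^* x = k = l^2. *)
Lemma posc_starM r x : in_corner x -> 0 < r -> nr x <= r ->
  posc (r ^+ 2) (star x ** x).
Proof.
move=> xc r0 xr; set h := star x ** x.
have hs : star h = h by rewrite starM starK.
have hc : in_corner h by apply: in_cornerM => //; exact: in_corner_star.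
have s0 : 0 < nr h + 1 by have := nr_ge0 h; lra.
have /(posc_sq hs hc s0) hp : nr h <= nr h + 1 by rewrite lerDl.
have [k [kp kk kC]] := posc_sqrt hp s0.
have [u u0 uE] := posc_sqr_root kp; rewrite uE in kp.
have [l [[ls lc _ _] ll lC]] := posc_sqrt kp u0.
have [ks kc _ _] := kp.
have hk : h ** k = k ** h by apply: kC; rewrite ?amulA.
have mc : in_corner (k - h) by exact: in_cornerB.
have ms : star (k - h) = k - h by rewrite starB ks hs.
have hl : h ** l = l ** h by apply: lC.
have kl : k ** l = l ** k by apply: lC.
have lm : l ** (k - h) = (k - h) ** l by rewrite amulBr amulBl hl kl.
have hm : h ** (k - h) = - (k ** (k - h)).
  by rewrite !amulBr kk hk opprB.
have y0 : x ** (k - h) = 0.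
  apply: (@starM_eq_neg_sq _ (l ** (k - h))).
  - exact: in_cornerM.
  - by rewrite starM ms ls lm.
  - exact: in_cornerM.
  rewrite starM ms -amulA (amulA (star x)) -/h hm amulNr.
  by congr (- _); rewrite {1}lm -!amulA (amulA l l) ll.
have k0 : l ** (k - h) = 0.
  apply: starM0; rewrite starM ms ls -amulA (amulA l) ll.
  have -> : k ** (k - h) = - (h ** (k - h)) by rewrite hm opprK.
  by rewrite /h -amulA y0 amul0r oppr0 amul0r.
have m0 : k - h = 0.
  have km : k ** (k - h) = 0 by rewrite -{1}ll -amulA k0 amul0r.
  apply: starM0; rewrite ms amulBl km.
  by rewrite /h -amulA y0 amul0r subrr.
have {}kh : k = h by apply/eqP; rewrite -subr_eq0 m0.
have xx : star x ** x = l ** l by rewrite ll kh.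
rewrite /h xx; apply: posc_sq => //.
rewrite -(@ler_pXn2r _ 2) ?nnegrE ?nr_ge0 ?(ltW r0)//.
by rewrite -(nr_sa ls) -xx nr_starM ler_pXn2r ?nnegrE ?nr_ge0 ?(ltW r0).
Qed.

(** Let S be the whole sum. Then r e - S is positive because |S| <= r, so r e - x^* x = (r e - S) +
    w^* w is positive too, and [posc_le] applies. *)
Lemma nr_le_starMD r x w : in_corner x -> in_corner w ->
  0 < r -> nr (star x ** x + star w ** w) <= r -> nr x ^+ 2 <= r.
Proof.
move=> xc wc r0 Sr; have [es ee] := e_proj.
have xp : posc ((nr x + 1) ^+ 2) (star x ** x).
  by apply: posc_starM; rewrite ?lerDl// ltr_wpDl ?nr_ge0.
have wp : posc ((nr w + 1) ^+ 2) (star w ** w).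
  by apply: posc_starM; rewrite ?lerDl// ltr_wpDl ?nr_ge0.
rewrite -nr_starM; apply: (posc_le (s := r + (nr w + 1) ^+ 2) xp) (ltW r0).
have -> : r%:C *: e - star x ** x =
    (r%:C *: e - (star x ** x + star w ** w)) + star w ** w by nc.
have [? ? _ _] := xp; have [? ? _ _] := wp; apply: poscD wp.
have SC : in_corner (star x ** x + star w ** w) by exact: in_cornerD.
split=> //.
- by rewrite starB starZr es starD !starM !starK.
- by apply: in_cornerB => //; apply: in_cornerZ; exact: in_corner_unit.
by rewrite opprB addrC subrK.
Qed.

End Corner.

(** * From corners to the whole algebra *)

Section ProjectionApproximation.
Context {R : realType} {C : cstarAlgType R[i]}.
Implicit Types p x y w : C.

Definition projection_approximable :=
  forall (s : seq C) (eps : R), 0 < eps -> exists p, projection p /\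
    forall c, c \in s -> nr (p ** c - c) < eps /\ nr (c ** p - c) < eps.

(** A projection p that fixes y and w up to d moves the relation into the corner of p, where
    [nr_le_starMD] bounds the compression of y; then d tends to 0. *)
Lemma starM_add_eq0 y w : projection_approximable ->
  star y ** y + star w ** w = 0 -> y = 0.
Proof.
move=> hC yw0; apply: nr0_eq0; apply/eqP; rewrite -(sqrf_eq0 (nr y)).
apply/eqP/le_anti; rewrite exprn_ge0 ?nr_ge0// andbT.
(* For the radius r chosen below and d < 1, M d bounds 2 r + 8 d^2; this comes from (a + 2 d)^2 <= 2
   a^2 + 8 d^2. *)
pose M := 2 * (4 * (nr y + nr w) + 1) + 8.
have M0 : 0 < M by have := nr_ge0 y; have := nr_ge0 w; rewrite /M; lra.
suff h d : 0 < d -> d < 1 -> nr y ^+ 2 <= M * d.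
  apply/ler_addgt0Pr => d d0; rewrite add0r.
  have d1 : 0 < Num.min (d / M) (2^-1) by rewrite lt_min divr_gt0//=.
  have := h _ d1; rewrite gt_min invf_lt1 ?ltr1n// orbT => /(_ isT) h1.
  by rewrite (le_trans h1)// mulrC -ler_pdivlMr// ge_min lexx.
move=> d0 d1; have [p [pp hp]] := hC [:: y; w] _ d0.
have p1 := nr_proj_le1 pp; have [ps ppp] := pp.
pose Y := p ** y ** p; pose W := p ** w ** p.
have cut z : z \in [:: y; w] -> [/\ in_corner p (p ** z ** p),
    nr (p ** z ** p - z) <= 2 * d, nr (p ** z ** p) <= nr z &
    nr (star (p ** z ** p) ** (p ** z ** p) - star z ** z) <= 4 * d * nr z].
  move=> /hp[h1 h2]; have c1 : in_corner p (p ** z ** p).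
    by split; [rewrite !amulA ppp|rewrite -(amulA (p ** z)) ppp].
  have c2 : nr (p ** z ** p - z) <= 2 * d.
    have -> : p ** z ** p - z = p ** (z ** p - z) + (p ** z - z) by nc.
    have := nrM_le p1 (ltW h2); have := nrD (p ** (z ** p - z)) (p ** z - z).
    by lra.
  have c3 : nr (p ** z ** p) <= nr z.
    by have := nrM_le (nrM_le p1 (lexx (nr z))) p1; rewrite mulr1 mul1r.
  split=> //; set Z := p ** z ** p.
  have -> : star Z ** Z - star z ** z = star (Z - z) ** Z + star z ** (Z - z).
    by rewrite starB; nc.
  have := nrD (star (Z - z) ** Z) (star z ** (Z - z)).
  have c4 : nr (star (Z - z)) <= 2 * d by rewrite nr_star.
  have c5 : nr (star z) <= nr z by rewrite nr_star.
  have := nrM_le c4 c3; have := nrM_le c5 c2; lra.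
have [|Yc Yd Yn Ys] := cut y; first by rewrite !inE eqxx.
have [|Wc Wd Wn Ws] := cut w; first by rewrite !inE eqxx orbT.
(* The compressed sum has norm at most 4 d (|y| + |w|); the summand 1 keeps r positive. *)
pose r := (4 * (nr y + nr w) + 1) * d.
have r0 : 0 < r by rewrite mulr_gt0//; have := nr_ge0 y; have := nr_ge0 w; lra.
have := nr_le_starMD pp Yc Wc r0.
have -> : star (p ** y ** p) ** (p ** y ** p) + star (p ** w ** p) ** (p ** w ** p)
  = (star (p ** y ** p) ** (p ** y ** p) - star y ** y) +
    (star (p ** w ** p) ** (p ** w ** p) - star w ** w).
  by rewrite addrACA -opprD yw0 subr0.
move=> h1; have {}h1 : nr (p ** y ** p) ^+ 2 <= r.
  by apply: h1; rewrite (le_trans (nrD _ _))// /r; lra.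
have := nr_tri0 (p ** y ** p) y; rewrite nrBC => h2.
have h3 : nr y ^+ 2 <= (nr (p ** y ** p) + 2 * d) ^+ 2.
  rewrite lerXn2r ?nnegrE ?nr_ge0//; last by lra.
  by have := nr_ge0 (p ** y ** p); lra.
have h4 : d * d <= d * 1 by rewrite ler_wpM2l ?(ltW d0) ?(ltW d1).
have := sqr_ge0 (nr (p ** y ** p) - 2 * d).
move: h3 h1; rewrite /r /M; nra.
Qed.

(** With q - p = x^* x, compressing p + x^* x = q by 1 - q gives 0, as a sum of two terms of the
    form z^* z with z = p (1 - q) and z = x (1 - q). *)
Lemma projection_le p q : projection_approximable ->
  projection p -> projection q -> positive (q - p) -> q ** p = p.
Proof.
move=> hC [ps pp] [qs qq] [x xE].
have : star (p - p ** q) ** (p - p ** q) + star (x - x ** q) ** (x - x ** q) = 0.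
  transitivity (star (p - p ** q) ** (p - p ** q) +
    ((q - p) - (q - p) ** q - q ** (q - p) + q ** (q - p) ** q)).
    by rewrite {1 2 3 4}xE !starB !starM !qs !ps; nc.
  rewrite starB starM qs ps.
  transitivity (p ** p - p ** p ** q - q ** (p ** p) + q ** (p ** p) ** q +
    ((q - p) - (q ** q - p ** q) - (q ** q - q ** p) +
     (q ** q ** q - q ** p ** q))); first by nc.
  by rewrite pp !qq; nc.
move=> /(starM_add_eq0 hC)/eqP; rewrite subr_eq0 => /eqP h.
by rewrite -{1}ps -qs -starM -h ps.
Qed.

End ProjectionApproximation.

(** * Equivalent subprojections from simplicity and (SP) *)

Section Comparison.
Context {R : realType} {C : cstarAlgType R[i]}.
Implicit Types e g h p q r s x y z v w : C.

(** The sum w of the powers y^n with n >= 1, so that e + w inverts e - y in the corner. *)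
Lemma neumann e y : projection e -> in_corner e y -> star y = y -> nr y < 1 ->
  exists w, [/\ in_corner e w, star w = w, w = y + y ** w & y ** w = w ** y].
Proof.
move=> ep [ey ye] ys y1.
pose u := fix u n := if n is n'.+1 then y + y ** u n' else 0 : C.
have d0 : 0 < 1 - nr y by lra.
(* Minus the tail of the geometric series: its increments are |y|^(n+1), and 0 bounds it from
   above. *)
pose t n : R := - (nr y ^+ n.+1 / (1 - nr y)).
have uS n : u n.+1 = y + y ** u n by [].
have ud n : nr (u n.+1 - u n) <= t n.+1 - t n.
  have -> : t n.+1 - t n = nr y ^+ n.+1.
    by rewrite /t (exprS _ n.+1); field; rewrite gt_eqF.
  elim: n => [|n IH]; first by rewrite /= amul0r addr0 subr0 expr1.
  have -> : u n.+2 - u n.+1 = y ** (u n.+1 - u n).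
    by rewrite (uS n.+1) [in X in _ - X]uS; nc.
  by rewrite (exprS _ n.+1) nrM_le.
have t0 n : t n <= 0.
  by rewrite oppr_le0 divr_ge0 ?exprn_ge0 ?nr_ge0// ltW.
have [w uw] := cvs_majorant ud t0.
have yu n : y ** u n = u n ** y.
  elim: n => [|n IH]; first by rewrite /= amul0l amul0r.
  by rewrite uS amulDr amulDl IH !amulA IH.
have wy : y ** w = w ** y.
  apply: cvs_uniq (cvsMl y uw) _; apply: eq_cvs (cvsMr y uw).
  by exists 0%N => n _; rewrite yu.
have wE : w = y + y ** w.
  apply: cvs_uniq (cvs_shift uw) _.
  apply: (eq_cvs (u := fun n => y + y ** u n)); first by exists 0%N.
  by apply: cvsD; [exact: cvs_cst|exact: cvsMl].
have ws : star w = w.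
  apply: cvs_uniq (cvs_star uw) _; apply: eq_cvs uw; exists 0%N => n _.
  elim: n => [|n IH]; first by rewrite /= star0.
  by rewrite uS starD starM ys -IH yu.
exists w; split=> //; split.
  by rewrite {1}wE amulDr ey amulA ey -wE.
by rewrite {1}wE wy amulDl ye -amulA ye -wy -wE.
Qed.

(** Here h = (e - y)^2 with |y| <= |e - h| < 1, so g is the Neumann inverse of e - y. *)
Lemma inverse_sqrt e h : projection e -> in_corner e h -> star h = h ->
  nr (e - h) < 1 ->
  exists g, [/\ in_corner e g, star g = g & g ** h ** g = e].
Proof.
move=> ep hc hs h1; have [es ee] := ep; have [eh he] := hc.
have ts : star (e - h) = e - h by rewrite starB es hs.
have [y [ys yy yt yC]] := sqrt_one_minus ts (ltW h1).
have y1 := le_lt_trans yt h1.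
have ye : e ** y = y ** e by apply: yC; rewrite amulBr amulBl eh he.
have ey : e ** y = y.
  apply/eqP; rewrite -subr_eq0; apply/eqP.
  apply: (addrr_mul_eq0 _ (ltW y1)).
  transitivity (e ** (y + y) - (y + y)); first by nc.
  by rewrite yy amulDr amulBr ee eh; nc.
have yc : in_corner e y by split=> //; rewrite -ye.
have [w [wc ws wE yw]] := neumann ep yc ys y1.
have [ew we] := wc.
have gi : (e - y) ** (e + w) = e.
  transitivity (e ** e + e ** w - y ** e - y ** w); first by nc.
  by rewrite ee ew -ye ey {1}wE; nc.
have ig : (e + w) ** (e - y) = e.
  transitivity (e ** e - e ** y + w ** e - w ** y); first by nc.
  by rewrite ee we ey -yw {1}wE; nc.
exists (e + w); split.
- by apply: in_cornerD => //; exact: in_corner_unit.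
- by rewrite starD es ws.
have -> : h = (e - y) ** (e - y).
  transitivity (e ** e - e ** y - y ** e + y ** y); last by nc.
  rewrite ee -ye ey; have -> : y ** y = (y + y) - (e - h) by rewrite yy; nc.
  by nc.
by rewrite amulA ig -amulA gi.
Qed.

Lemma closed_nr (B : set C) :
  (forall x, (forall eps : R, 0 < eps -> exists2 y, B y & nr (x - y) < eps) ->
    B x) -> closed B.
Proof.
move=> BC x clx; apply: BC => eps eps0.
have [|y [By]] := clx (ball x eps%:C).
  by apply: nbhsx_ballx; rewrite ltcR.
by rewrite -ball_normE/= nrE ltcR => ?; exists y.
Qed.

Lemma lipschitz_eq0 (M : R) (f : C -> C) x :
  (forall y z, nr (f y - f z) <= M * nr (y - z)) ->
  (forall eps : R, 0 < eps -> exists2 y, f y = 0 & nr (x - y) < eps) -> f x = 0.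
Proof.
move=> fM h; apply: nr_small => eps eps0.
have M0 : 0 < `|M| + 1 by rewrite ltr_wpDl.
have [y y0] := h _ (divr_gt0 eps0 M0); rewrite ltr_pdivlMr// => h1.
have := fM x y; rewrite y0 subr0; have := ler_norm M.
have := nr_ge0 (x - y); nra.
Qed.

Lemma lipschitz_mull x : forall y z, nr (x ** y - x ** z) <= nr x * nr (y - z).
Proof. by move=> y z; rewrite -amulBr nrM. Qed.

Lemma lipschitz_mulr x : forall y z, nr (y ** x - z ** x) <= nr x * nr (y - z).
Proof. by move=> y z; rewrite -amulBl mulrC nrM. Qed.

(** If q C r = 0, the elements annihilated by q C from the left form a closed ideal that contains r.
    By simplicity it contains q, and q = q q q = 0. *)
Lemma simple_prime q r : simple C -> projection q -> q != 0 -> r != 0 ->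
  exists c, q ** c ** r != 0.
Proof.
move=> Cs [qs qq] q0 r0; apply: contrapT => /forallNP h.
have {}h c : q ** c ** r = 0 by apply/eqP; apply: contraPT (h c) => ?.
have [|J0|JT] := Cs [set y | forall c, q ** c ** y = 0] _.
- split=> [| c|k x y hx hy c|a x hx].
  + apply: closed_nr => x hx c; apply: (lipschitz_eq0 (lipschitz_mull (q ** c))).
    by move=> eps /hx[y hy yx]; exists y.
  + by rewrite amul0r.
  + by rewrite amulDr amulZr hx hy scaler0 addr0.
  + by split=> c; rewrite amulA ?hx ?amul0l// -(amulA q) hx.
- have : [set y | forall c, q ** c ** y = 0] r by [].
  by rewrite J0 => /= /eqP; rewrite (negbTE r0).
have : [set y | forall c, q ** c ** y = 0] q by rewrite JT.
by move=> /(_ q); rewrite !qq => /eqP; rewrite (negbTE q0).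
Qed.

(** If b = y^* y + w^* w, compressing by m and by 1 - r gives sums that vanish, so y m = 0 and y (1
    - r) = 0 by [starM_add_eq0]. With m a negative part, this set replaces the spectral subspace of
    the positive part. *)
Lemma annihilator_hereditary r m : projection_approximable (C := C) ->
  projection r -> star m = m ->
  hereditary [set b | in_corner r b /\ (m ** b = 0 /\ b ** m = 0)].
Proof.
move=> hC rp ms; have [rs rr] := rp; split.
  split.
  - apply: closed_nr => x hx; split; split.
    + apply/eqP; rewrite -subr_eq0; apply/eqP.
      apply: (lipschitz_eq0 (M := nr r + 1) (f := fun x => r ** x - x)).
        move=> y z; have -> : r ** y - y - (r ** z - z) = r ** (y - z) - (y - z) by nc.
        by rewrite mulrDl mul1r (le_trans (nrB _ _))// lerD2r nrM.
      by move=> eps /hx[y [[yr _] _] yx]; exists y => //; rewrite yr subrr.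
    + apply/eqP; rewrite -subr_eq0; apply/eqP.
      apply: (lipschitz_eq0 (M := nr r + 1) (f := fun x => x ** r - x)).
        move=> y z; have -> : y ** r - y - (z ** r - z) = (y - z) ** r - (y - z) by nc.
        by rewrite mulrDl mul1r (le_trans (nrB _ _))// lerD2r mulrC nrM.
      by move=> eps /hx[y [[_ yr] _] yx]; exists y => //; rewrite yr subrr.
    + apply: (lipschitz_eq0 (lipschitz_mull m)).
      by move=> eps /hx[y [_ [? _]] yx]; exists y.
    + apply: (lipschitz_eq0 (f := fun x => x ** m) (lipschitz_mulr m)).
      by move=> eps /hx[y [_ [_ ?]] yx]; exists y.
  - by split; [split|]; rewrite !(amul0l, amul0r).
  - move=> k x y [xr [mx xm]] [yr [my ym]]; split.
      by apply: in_cornerD => //; exact: in_cornerZ.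
    by rewrite amulDr amulDl amulZr amulZl mx my xm ym scaler0 addr0.
  - move=> x y [xr [mx xm]] [yr [my ym]]; split; first exact: in_cornerM.
    by rewrite amulA mx -amulA ym amul0l amul0r.
  - move=> x [xr [mx xm]]; split; first exact: in_corner_star.
    by split; rewrite -{1}ms -starM ?mx ?xm star0.
move=> a b [y ya] [w wb] [[rb br] [mb bm]].
have bE : b = star y ** y + star w ** w by rewrite -wb ya addrCA subrr addr0.
have ym : y ** m = 0.
  apply: (starM_add_eq0 (w := w ** m) hC); rewrite !starM ms.
  transitivity (m ** (star y ** y + star w ** w) ** m); first by nc.
  by rewrite -bE mb amul0l.
have yr : y - y ** r = 0.
  apply: (starM_add_eq0 (w := w - w ** r) hC); rewrite !starB !starM rs.
  transitivity ((star y ** y + star w ** w) - r ** (star y ** y + star w ** w) -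
    (star y ** y + star w ** w) ** r + r ** (star y ** y + star w ** w) ** r).
    by nc.
  by rewrite -bE rb br; nc.
have {}yr : y ** r = y by apply/esym/eqP; rewrite -subr_eq0 yr.
have ry : r ** star y = star y by rewrite -{1}rs -starM yr.
have my : m ** star y = 0 by rewrite -ms -starM ym star0.
by rewrite ya; split; split;
   rewrite ?amulA ?ry ?my ?amul0l// -amulA ?yr ?ym ?amul0r.
Qed.

(* With x = q c r of norm 1 and h = x^* x, hereditarity produces a projection s
   under the spectral subspace h >= 1/2, so that s h s is invertible in s C s
   and the polar part of x s is a partial isometry. *)
Lemma exists_subequivalent q r : projection_approximable (C := C) ->
  simple C -> property_SP C -> projection q -> projection r ->
  q != 0 -> r != 0 -> q ** r = 0 ->
  exists s v, [/\ projection s, s != 0, r ** s = s, star v ** v = s & q ** v = v].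
Proof.
move=> hC Cs SP qp rp q0 r0 qr; have [qs qq] := qp; have [rs rr] := rp.
have rq : r ** q = 0 by rewrite -rs -qs -starM qr star0.
have [c c0] := simple_prime Cs qp q0 r0.
have n0 := nr_gt0 c0.
pose x := (nr (q ** c ** r))^-1%:C *: (q ** c ** r).
have x1 : nr x = 1.
  by rewrite nrZr ger0_norm ?invr_ge0 ?(ltW n0)// mulVf// gt_eqF.
have qx : q ** x = x by rewrite amulZr !amulA qq.
have xr : x ** r = x by rewrite amulZl -(amulA (q ** c)) rr.
have rxs : r ** star x = star x by rewrite -{1}rs -starM xr.
pose h := star x ** x.
have hs : star h = h by rewrite starM starK.
have hc : in_corner r h by split; rewrite ?amulA ?rxs// -amulA xr.
have [rh hr] := hc.
have h1 : nr h = 1 by rewrite nr_starM x1 expr1n.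
have hp : posc r 1 h.
  split=> //; rewrite rmorph1 scale1r.
  (* As x maps from r to q, it lies in the corner of q + r but not of r; positivity of x^* x is
     obtained there and compressed to r. *)
  have ep : projection (q + r).
    by split; rewrite ?starD ?qs ?rs// amulDl !amulDr qq qr rq rr addr0 add0r.
  have xc : in_corner (q + r) x.
    split.
      by rewrite amulDl qx -qx amulA rq amul0l addr0.
    by rewrite amulDr xr -{1}xr -amulA rq amul0r add0r.
  have x1' : nr x <= 1 by rewrite x1.
  have [_ _ _] := posc_starM ep xc ltr01 x1'.
  rewrite expr1n rmorph1 scale1r -/h => e1.
  have -> : r - h = r ** (q + r - h) ** r.
    transitivity (r ** q ** r + r ** r ** r - r ** h ** r); last by nc.
    by rewrite rq amul0l add0r !rr rh hr.
  have r1 := nr_proj_le1 rp.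
  by have := nrM_le (nrM_le r1 e1) r1; rewrite !mulr1.
have kp' : posc r 1 (r - h).
  split=> //; first by rewrite starB rs hs.
    by apply: in_cornerB => //; exact: in_corner_unit.
  by rewrite rmorph1 scale1r opprB addrC subrK h1.
(* The threshold 1/2 for h becomes the threshold 0 for a. Below, k is |a|, while f and m are twice
   the positive and negative parts of a. *)
pose a := h + h - r.
have as_ : star a = a by rewrite starB starD hs rs.
have ac : in_corner r a.
  by apply: in_cornerB; [exact: in_cornerD|exact: in_corner_unit].
(* Here a = h - (r - h), a difference of two commuting squares with sum r. *)
have a1 : nr a <= 1.
  rewrite -(expr1n _ 2) in hp kp'.
  have [f [[fs fc _ _] ff fC]] := posc_sqrt rp hp ltr01.
  have [g [[gs gc _ _] gg gC]] := posc_sqrt rp kp' ltr01.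
  have fg : f ** g = g ** f.
    by apply: gC => //; rewrite amulBr amulBl (in_cornerC fc) -ff amulA.
  have := nr_commuting_sqs fs gs fg; rewrite ff gg.
  have -> : h + (r - h) = r by rewrite addrC subrK.
  have -> : h - (r - h) = a by rewrite /a; nc.
  by move=> h2; rewrite (le_trans h2)// nr_proj_le1.
have [k [[ks kc _ k1] kk kC]] := posc_sqrt rp (posc_sq rp as_ ac ltr01 a1) ltr01.
rewrite rmorph1 scale1r in k1.
have ak : a ** k = k ** a by apply: kC => //; rewrite amulA.
pose m := k - a; pose f := k + a.
have ms : star m = m by rewrite starB ks as_.
have mf : m ** f = 0.
  transitivity (k ** k - a ** a + (k ** a - a ** k)); first by rewrite /m /f; nc.
  by rewrite kk ak !subrr addr0.
have fm : f ** m = 0.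
  by rewrite -[f]/(k + a) -{1}ks -{1}as_ -starD -ms -starM mf star0.
have fc : in_corner r f by exact: in_cornerD.
(* Otherwise r - 2 h = k is positive, so |2 h| <= 1, against |h| = 1. *)
have f0 : f != 0.
  apply/eqP => f0; have kE : k = (1 : R)%:C *: r - (h + h).
    by rewrite rmorph1 scale1r -opprB -/a; apply/eqP; rewrite -addr_eq0; apply/eqP.
  have kp : posc r 1 ((1 : R)%:C *: r - (h + h)).
    by rewrite -kE; split=> //; rewrite rmorph1 scale1r.
  have := posc_le rp (poscD hp hp) kp ler01.
  have -> : h + h = (2 : R)%:C *: h by rewrite rmorph_nat; nc.
  by rewrite nrZr h1 ger0_norm//; lra.
have [|s [[sc [mss sm]] sp s0]] := SP _ (annihilator_hereditary hC rp ms).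
  by exists f.
have [ss s2] := sp; have [rS sr] := sc.
have sks : k ** s = a ** s.
  by apply/eqP; rewrite -subr_eq0 -amulBl mss.
pose H := s ** h ** s.
(* On s the elements a and k agree, so s - H is half of s (r - k) s and has norm at most 1/2. *)
have HH : 2^-1 *: (s ** (r - k) ** s) = s - H.
  transitivity (2^-1 *: (s ** r ** s - s ** (k ** s))); first by nc.
  rewrite sks sr s2 /a /H.
  transitivity (2^-1 *: (s - (s ** h ** s + s ** h ** s - s ** r ** s))).
    by nc.
  by rewrite sr s2; nc.
have H1 : nr (s - H) < 1.
  rewrite -HH nr_half; have s1 := nr_proj_le1 sp.
  have := nrM_le (nrM_le s1 k1) s1; rewrite !mulr1; lra.
have [||g [[sg gs] gss gH]] := inverse_sqrt sp (h := H) _ _ H1.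
- by split; rewrite /H; [rewrite !amulA s2|rewrite -(amulA (s ** h)) s2].
- by rewrite /H starM (starM s h) hs ss amulA.
exists s, (x ** g); split=> //; last by rewrite amulA qx.
have gE t : g ** (s ** t ** s) ** g = g ** t ** g.
  by rewrite !amulA gs -(amulA (g ** t)) sg.
by rewrite starM gss -amulA (amulA _ x) -/h amulA -gE.
Qed.

(* The [v i ** star (v j)] form a system of matrix units. *)
Lemma exists_column_isometries (q : nat -> C) n :
  projection_approximable (C := C) -> simple C -> property_SP C ->
  (forall i, (i <= n)%N -> projection (q i) /\ q i != 0) ->
  (forall i j, (i <= n)%N -> (j <= n)%N -> i != j -> q i ** q j = 0) ->
  exists s (v : nat -> C), [/\ projection s, s != 0,
    forall i, (i <= n)%N -> q i ** v i = v i
    & forall i j, (i <= n)%N -> (j <= n)%N ->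
        star (v i) ** v j = if i == j then s else 0].
Proof.
move=> hC Cs SP qp qo.
(* Orthogonality of the columns follows from that of the q i. The clause that s lies below q 0 makes
   s orthogonal to q n.+1 in the induction; the new s is a subprojection t of the old one, and the
   earlier v i are cut down to v i t. *)
suff [s [v [sp s0 sq qv vv]]] : exists s (v : nat -> C),
  [/\ projection s, s != 0, q 0%N ** s = s,
    forall i, (i <= n)%N -> q i ** v i = v i
    & forall i, (i <= n)%N -> star (v i) ** v i = s].
  exists s, v; split=> // i j ni nj; case: eqVneq => [<-|ij]; first exact: vv.
  rewrite -(qv _ ni) -(qv _ nj) starM (proj1 (proj1 (qp _ ni))).
  by rewrite amulA -(amulA _ (q i)) qo// amul0r amul0l.
elim: n qp qo => [|n IH] qp qo.
  have [q0p q0] := qp _ (leqnn _); have [q0s q00] := q0p.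
  exists (q 0%N), (fun=> q 0%N).
  by split=> // i; [rewrite leqn0 => /eqP ->|rewrite q0s].
have [i ni|i j ni nj|s [v [sp s0 sq qv vv]]] := IH.
- by apply: qp; exact: leqW.
- by apply: qo; exact: leqW.
have [qnp qn0] := qp _ (leqnn n.+1).
have [ss s2] := sp.
have qs : q n.+1 ** s = 0 by rewrite -sq amulA qo// amul0l.
have [t [w [tp t0 st wt qw]]] := exists_subequivalent hC Cs SP qnp sp qn0 s0 qs.
have [ts tt] := tp.
exists t, (fun i => if (i <= n)%N then v i ** t else w); split=> //.
- by rewrite -st amulA sq.
- move=> i; rewrite leq_eqVlt ltnS => /predU1P[->|ni]; first by rewrite ltnn.
  by rewrite ni amulA qv.
move=> i; rewrite leq_eqVlt ltnS => /predU1P[->|ni]; first by rewrite ltnn.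
by rewrite ni starM ts -amulA (amulA _ (v i)) vv// st tt.
Qed.

End Comparison.

(** * Norms of orthogonal sums *)

Section OrthogonalSums.
Context {R : realType} {C : cstarAlgType R[i]}.

Fixpoint isq (x : C) k := if k is k'.+1 then isq x k' ** isq x k' else x.

Lemma nr_isq x k : star x = x -> nr (isq x k) = nr x ^+ (2 ^ k).
Proof.
move=> xs; have hs j : star (isq x j) = isq x j.
  by elim: j => //= j IH; rewrite starM IH.
elim: k => [|k IH]; first by rewrite expr1.
by rewrite [isq _ _]/= nr_sa// IH -exprM expnS mulnC.
Qed.

Lemma orthogonal_sumM (b c : nat -> C) (r : seq nat) : uniq r ->
  (forall i j, i != j -> b i ** c j = 0) ->
  (\sum_(i <- r) b i) ** (\sum_(i <- r) c i) = \sum_(i <- r) b i ** c i.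
Proof.
move=> ur bc; rewrite amul_suml; apply: eq_big_seq => i ir.
rewrite amul_sumr (bigD1_seq i)//= big1 ?addr0// => j ji.
by rewrite bc// eq_sym.
Qed.

(** Orthogonality lets the iterated squares of h be computed term by term. The triangle inequality
    then loses only the factor [size r], which [root_bound] removes. *)
Lemma nr_orthogonal_sum (b : nat -> C) (r : seq nat) (M : R) : uniq r ->
  0 <= M -> (forall i, i \in r -> nr (b i) <= M) ->
  (forall i j, i != j -> star (b i) ** b j = 0 /\ b i ** star (b j) = 0) ->
  nr (\sum_(i <- r) b i) <= M.
Proof.
move=> ur M0 bM bo; rewrite -(@ler_pXn2r _ 2) ?nnegrE ?nr_ge0//.
rewrite -nr_starM star_sum orthogonal_sumM//; last by move=> i j /bo[].
set h := \sum_(i <- r) _; pose c i := star (b i) ** b i.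
have hs : star h = h.
  by rewrite star_sum; apply: eq_bigr => i _; rewrite starM starK.
have co k i j : i != j -> isq (c i) k ** isq (c j) k = 0.
  move=> ij; elim: k => [|k IH] /=.
    by rewrite /c amulA -(amulA _ (b i)) (bo _ _ ij).2 amul0r amul0l.
  by rewrite amulA -(amulA (isq (c i) k)) IH amul0r amul0l.
have hk k : isq h k = \sum_(i <- r) isq (c i) k.
  by elim: k => //= k ->; rewrite orthogonal_sumM// => i j /co.
have ck k i : i \in r -> nr (isq (c i) k) <= (M ^+ 2) ^+ (2 ^ k).
  move=> /bM bi; rewrite nr_isq ?starM ?starK// nr_starM.
  rewrite lerXn2r ?nnegrE ?exprn_ge0 ?nr_ge0//.
  by rewrite lerXn2r ?nnegrE ?nr_ge0.
apply: (@root_bound _ _ _ (size r)%:R 0) => [||k]; rewrite ?nr_ge0 ?exprn_ge0//.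
rewrite mul0r addr0 -nr_isq// hk (le_trans (nr_sum _ _ _))//.
have -> : (size r)%:R * (M ^+ 2) ^+ (2 ^ k) = \sum_(i <- r) (M ^+ 2) ^+ (2 ^ k).
  by rewrite big_const_seq count_predT iter_addr_0 mulr_natl.
by rewrite big_seq [leRHS]big_seq; apply: ler_sum => i; exact: ck.
Qed.

End OrthogonalSums.

(** * An increasing sequence of projections and its gaps *)

Section ProjectionSequence.
Context {R : realType} {C : cstarAlgType R[i]}.

Lemma directed_bound (I : Type) (le : I -> I -> Prop) (T : eqType)
    (P : T -> I -> Prop) (s : seq T) : directed le ->
  (forall c, exists i0, forall i, le i0 i -> P c i) ->
  exists i0, forall i, le i0 i -> forall c, c \in s -> P c i.
Proof.
move=> [[i1] _ letr leub] hP; elim: s => [|c s [i0 h0]]; first by exists i1.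
have [ic hc] := hP c; have [k [k0 kc]] := leub i0 ic.
exists k => i ki d; rewrite inE => /predU1P[->|ds].
  by apply: hc; exact: letr kc ki.
by apply: h0 => //; exact: letr k0 ki.
Qed.

Lemma projection_approximableP : has_projection_approximate_identity C ->
  projection_approximable (C := C).
Proof.
move=> [I [le [e [[dle _ _ eC] ep]]]] s eps eps0.
have eps0' : 0 < eps%:C by rewrite ltcR.
have [i0 h0] := directed_bound s dle (fun c => eC c _ eps0').
have [_ lerefl _ _] := dle.
exists (e i0); split => // c /(h0 _ (lerefl _)).
by rewrite !nrE !ltcR.
Qed.

Definition approximate_unit (f : nat -> C) :=
  [/\ forall n, projection (f n),
      forall m n, (m <= n)%N -> f n ** f m = f m
    & forall c, cvs (fun n => f n ** c) c /\ cvs (fun n => c ** f n) c].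

(** The sequence u need not consist of projections, and the net e need not be a sequence. An
    increasing choice of indices makes e (i n) fix u 0, ..., u n up to 1 / (n + 1); this suffices
    because every c is close to some u k c and c u k. *)
Lemma exists_approximate_unit : sigma_unital C ->
  has_projection_approximate_identity C -> exists f, approximate_unit f.
Proof.
move=> [u [_ _ _ uC]] hC; have pC := projection_approximableP hC.
have [I [le [e [[dle _ emono eC] ep]]]] := hC.
have [_ lerefl letr leub] := dle.
have /choice[t ht] : forall n, exists i0, forall i, le i0 i ->
    forall c, c \in [seq u k | k <- iota 0 n.+1] ->
    `|e i ** c - c| < (n.+1%:R^-1)%:C /\ `|c ** e i - c| < (n.+1%:R^-1)%:C.
  move=> n; apply: (directed_bound _ dle) => c; apply: eC.
  by rewrite ltcR invr_gt0.
have /choice[J hJ] : forall p : I * I, exists i, le p.1 i /\ le p.2 i.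
  by move=> p; exact: leub.
pose i := fix i n := if n is n'.+1 then J (i n', t n) else t 0%N.
have ti n : le (t n) (i n).
  by case: n => [|n]; [exact: lerefl|exact: (hJ (_, _)).2].
have ile m k : le (i m) (i (m + k)%N).
  elim: k => [|k IH]; first by rewrite addn0.
  by rewrite addnS; apply: letr IH _; exact: (hJ (_, _)).1.
have fu n k : (k <= n)%N -> nr (e (i n) ** u k - u k) < n.+1%:R^-1 /\
    nr (u k ** e (i n) - u k) < n.+1%:R^-1.
  move=> kn; have := ht n (i n) (ti n) (u k); rewrite !nrE !ltcR; apply.
  by rewrite map_f// mem_iota add0n ltnS.
exists (e \o i); split => [n|m n mn|c]; first exact: ep.
  by apply: (projection_le pC (ep _) (ep _)); rewrite -(subnKC mn); exact: emono.
have small eps : 0 < eps -> exists N, forall n, (N <= n)%N ->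
    n.+1%:R^-1 * nr c < eps.
  move=> eps0; exists (Num.bound (nr c / eps)) => n Nn.
  rewrite mulrC ltr_pdivrMr// mulrC -ltr_pdivrMr//.
  have := archi_boundP (divr_ge0 (nr_ge0 c) (ltW eps0)).
  move=> h; apply: lt_le_trans h _; rewrite ler_nat; exact: leqW.
split=> eps eps0; have e3 : 0 < eps / 3 by rewrite divr_gt0.
  have [k0 hk] := uC c _ (etrans (ltcR 0 (eps / 3)) e3).
  have [h1 _] := hk k0 (leqnn _); rewrite nrE ltcR in h1.
  have [N hN] := small _ e3; exists (maxn N k0) => n.
  rewrite geq_max => /andP[/hN h2 /fu [h3 _]].
  rewrite /=.
  have -> : e (i n) ** c - c = (u k0 ** c - c) - e (i n) ** (u k0 ** c - c)
     + (e (i n) ** u k0 - u k0) ** c by nc.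
  move: h2 h3; set d : R := _^-1 => h2 h3.
  have := nrM_le (nr_proj_le1 (ep (i n))) (ltW h1).
  have := nrM_le (ltW h3) (lexx (nr c)).
  have := nrD ((u k0 ** c - c) - e (i n) ** (u k0 ** c - c))
     ((e (i n) ** u k0 - u k0) ** c).
  have := nrB (u k0 ** c - c) (e (i n) ** (u k0 ** c - c)).
  lra.
have [k0 hk] := uC c _ (etrans (ltcR 0 (eps / 3)) e3).
have [_ h1] := hk k0 (leqnn _); rewrite nrE ltcR in h1.
have [N hN] := small _ e3; exists (maxn N k0) => n.
rewrite geq_max => /andP[/hN h2 /fu [_ h3]] /=.
have -> : c ** e (i n) - c = (c ** u k0 - c) - (c ** u k0 - c) ** e (i n)
   + c ** (u k0 ** e (i n) - u k0) by nc.
move: h2 h3; set d : R := _^-1 => h2 h3.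
have := nrM_le (ltW h1) (nr_proj_le1 (ep (i n))).
have := nrM_le (lexx (nr c)) (ltW h3).
have := nrD ((c ** u k0 - c) - (c ** u k0 - c) ** e (i n))
   (c ** (u k0 ** e (i n) - u k0)).
have := nrB (c ** u k0 - c) ((c ** u k0 - c) ** e (i n)).
lra.
Qed.

Section ApproximateUnit.
Variable f : nat -> C.
Hypothesis fP : approximate_unit f.

Lemma approximate_unit_projection n : projection (f n).
Proof. by case: fP. Qed.

Lemma approximate_unit_mulr m n : (m <= n)%N -> f n ** f m = f m.
Proof. by case: fP => _ h _; exact: h. Qed.

Lemma approximate_unit_mull m n : (m <= n)%N -> f m ** f n = f m.
Proof.
move=> mn; have [fm _] := approximate_unit_projection m.
have [fn _] := approximate_unit_projection n.
by rewrite -fm -{1}fn -starM approximate_unit_mulr.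
Qed.

Lemma approximate_unitM m n : f m ** f n = f (minn m n).
Proof.
have [mn|/ltnW nm] := leqP m n; first exact: approximate_unit_mull.
exact: approximate_unit_mulr.
Qed.

Lemma approximate_unit_gap_projection m n : (m <= n)%N -> projection (f n - f m).
Proof.
move=> mn; have [fm fmm] := approximate_unit_projection m.
have [fn fnn] := approximate_unit_projection n; split; first by rewrite starB fm fn.
transitivity (f n ** f n - f n ** f m - f m ** f n + f m ** f m); first by nc.
by rewrite fnn fmm (approximate_unit_mulr mn) (approximate_unit_mull mn); nc.
Qed.

Lemma approximate_unit_gap_orthogonal m n k l : (m <= n)%N -> (n <= k)%N ->
  (k <= l)%N ->
  (f n - f m) ** (f l - f k) = 0 /\ (f l - f k) ** (f n - f m) = 0.
Proof.
move=> mn nk kl; have nl := leq_trans nk kl.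
have mk := leq_trans mn nk; have ml := leq_trans mk kl.
rewrite !amulBl !amulBr !approximate_unitM !(minnC k) !(minnC l).
rewrite (minn_idPl nl) (minn_idPl nk) (minn_idPl ml) (minn_idPl mk).
by rewrite !subrr.
Qed.

Lemma approximate_unit_gap_absorb m n k l : (k <= m)%N -> (m <= n)%N ->
  (n <= l)%N -> (f l - f k) ** (f n - f m) = f n - f m.
Proof.
move=> km mn nl; rewrite amulBl !amulBr !approximate_unitM !(minnC l).
rewrite (minn_idPl nl) (minn_idPl (leq_trans mn nl)) (minn_idPl km).
by rewrite (minn_idPl (leq_trans km mn)) subrr subr0.
Qed.

Lemma approximate_unit_subseq (a : nat -> nat) :
  {homo a : m n / (m < n)%N >-> (m < n)%N} -> approximate_unit (f \o a).
Proof.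
move=> ainc; have ale : {homo a : m n / (m <= n)%N >-> (m <= n)%N}.
  by move=> m n; rewrite leq_eqVlt => /predU1P[->//|/ainc/ltnW].
have na n : (n <= a n)%N.
  by elim: n => // n IH; exact: leq_ltn_trans IH (ainc _ _ (ltnSn n)).
split=> [n|m n /ale mn|c]; first exact: approximate_unit_projection.
  exact: approximate_unit_mulr.
have [_ _ /(_ c)[c1 c2]] := fP.
by split=> eps eps0; [have [N hN] := c1 _ eps0|have [N hN] := c2 _ eps0];
   exists N => n Nn; apply: hN; exact: leq_trans (na n).
Qed.

Hypothesis nonunital : ~ unital C.

(** Otherwise the limit f n would be a unit of C. *)
Lemma approximate_unit_not_stationary n : exists2 m, (n < m)%N & f m - f n != 0.
Proof.
apply: contrapT => /forall2NP h; apply: nonunital; exists (f n) => c.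
have fn m : (n <= m)%N -> f m = f n.
  rewrite leq_eqVlt => /predU1P[->//|nm].
  by have [//|/negP] := h m; rewrite negbK subr_eq0 => /eqP.
have [_ _ /(_ c)[c1 c2]] := fP; split.
  apply: cvs_uniq c1; apply: (eq_cvs (u := fun=> f n ** c)); last exact: cvs_cst.
  by exists n => m /fn ->.
apply: cvs_uniq c2; apply: (eq_cvs (u := fun=> c ** f n)); last exact: cvs_cst.
by exists n => m /fn ->.
Qed.

(** The index bound is inclusive: one column more than the rank k is kept, so that rank 0 is no
    special case. *)
Definition column_isometries (e s : C) (v : nat -> C) k :=
  [/\ projection s, s != 0,
    forall i, (i <= k)%N -> e ** v i = v i
    & forall i j, (i <= k)%N -> (j <= k)%N ->
        star (v i) ** v j = if i == j then s else 0].

(** Iterating the choice of a larger index with nonzero gap yields k + 1 orthogonal nonzero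
    projections below a single gap, to which [exists_column_isometries] applies. *)
Lemma exists_gap : projection_approximable (C := C) -> simple C ->
  property_SP C -> forall n k, exists m s v, (n < m)%N /\
    column_isometries (f m - f n) s v k.
Proof.
move=> hC Cs SP n k.
have /choice[N hN] : forall n, exists m, (n < m)%N /\ f m - f n != 0.
  by move=> j; have [m] := approximate_unit_not_stationary j; exists m.
pose a i := iter i N n.
have aS i : (a i < a i.+1)%N by rewrite /a iterS; case: (hN (iter i N n)).
have aN i : f (a i.+1) - f (a i) != 0 by rewrite /a iterS; case: (hN (iter i N n)).
have ainc : {homo a : i j / (i <= j)%N >-> (i <= j)%N}.
  by apply: homo_leq => [//|? ? ?|i]; [exact: leq_trans|exact: ltnW].
have [i ik|i j ik jk|s [v [sp s0 qv vv]]] :=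
    @exists_column_isometries _ _ (fun i => f (a i.+1) - f (a i)) k hC Cs SP.
- split; last exact: aN.
  by apply: approximate_unit_gap_projection; exact: ltnW (aS i).
- rewrite neq_ltn => /orP[] ij; have ha := ainc _ _ ij.
    by have [] := approximate_unit_gap_orthogonal (ltnW (aS i)) ha (ltnW (aS j)).
  by have [] := approximate_unit_gap_orthogonal (ltnW (aS j)) ha (ltnW (aS i)).
exists (a k.+1), s, v; split.
  by apply: (leq_trans (aS 0%N)); exact: ainc.
split=> // i ik; rewrite -(qv _ ik) amulA approximate_unit_gap_absorb//.
- exact: (ainc 0%N).
- exact: ltnW.
- exact: ainc.
Qed.

End ApproximateUnit.

Lemma exists_block_structure (K : nat -> nat) : ~ unital C -> sigma_unital C ->
  has_projection_approximate_identity C -> simple C -> property_SP C ->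
  exists (g : nat -> C) (s : nat -> C) (v : nat -> nat -> C),
    approximate_unit g /\
    forall n, column_isometries (g n.+1 - g n) (s n) (v n) (K n).
Proof.
move=> Cnu Csu hC Cs SP; have [f fP] := exists_approximate_unit Csu hC.
have pC := projection_approximableP hC.
have /choice[nxt hnxt] : forall p : nat * nat,
    exists t : nat * (C * (nat -> C)), (p.1 < t.1)%N /\
    column_isometries (f t.1 - f p.1) t.2.1 t.2.2 p.2.
  move=> p; have [m [s [v h]]] := exists_gap fP Cnu pC Cs SP p.1 p.2.
  by exists (m, (s, v)).
pose a := fix a n := if n is n'.+1 then (nxt (a n', K n')).1 else 0%N.
exists (f \o a), (fun n => (nxt (a n, K n)).2.1), (fun n => (nxt (a n, K n)).2.2).
split; last by move=> n; have [_] := hnxt (a n, K n).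
apply: approximate_unit_subseq => //; apply: homo_ltn => [? ? ?|n].
  exact: ltn_trans.
by have [] := hnxt (a n, K n).
Qed.

End ProjectionSequence.

(** * Bounded operators and the operator norm *)

Section OperatorNorms.
Context {R : realType}.

(** The constant in [bounded_linear] is complex; comparing real parts leaves |Re c|. *)
Lemma bounded_linear_nr (V W : normedModType R[i]) (f : V -> W) :
  bounded_linear f -> exists2 M : R, 0 <= M & forall x, nr (f x) <= M * nr x.
Proof.
move=> [_ [c fc]]; exists `|complex.Re c| => // x.
have := fc x; rewrite !nrE => h.
have : nr (f x) <= complex.Re (c * (nr x)%:C).
  by move: h; rewrite lecE => /andP[_].
case: (c) => a b /=; rewrite mulr0 subr0 => h1; rewrite (le_trans h1)//.
by rewrite ler_wpM2r ?nr_ge0 ?ler_norm.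
Qed.

Lemma linear_fun0 (V W : normedModType R[i]) (f : V -> W) : linear f -> f 0 = 0.
Proof. by move=> lf; have := lf (-1) 0 0; rewrite scaler0 add0r scaleN1r addNr. Qed.

Lemma linear_funD (V W : normedModType R[i]) (f : V -> W) : linear f ->
  {morph f : x y / x + y}.
Proof. by move=> lf x y; have := lf 1 x y; rewrite !scale1r. Qed.

Lemma linear_funZ (V W : normedModType R[i]) (f : V -> W) k x : linear f ->
  f (k *: x) = k *: f x.
Proof. by move=> lf; have := lf k x 0; rewrite (linear_fun0 lf) !addr0. Qed.

Lemma linear_funB (V W : normedModType R[i]) (f : V -> W) : linear f ->
  {morph f : x y / x - y}.
Proof.
by move=> lf x y; rewrite linear_funD// -scaleN1r linear_funZ// scaleN1r.
Qed.

Lemma opnorm_has_sup (V W : normedModType R[i]) (f : V -> W) :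
  bounded_linear f ->
  has_sup [set complex.Re `|f x| | x in [set x : V | `|x| <= 1]].
Proof.
move=> /bounded_linear_nr[M M0 fM]; split.
  by exists (complex.Re `|f 0|), 0 => //=; rewrite normr0.
exists M => _ [x /= x1 <-]; rewrite (le_trans (fM x))// ler_piMr//.
by rewrite -lecR -nrE.
Qed.

Lemma opnorm_ge0 (V W : normedModType R[i]) (f : V -> W) :
  bounded_linear f -> 0 <= opnorm f.
Proof.
move=> fb; have [_ ub] := opnorm_has_sup fb.
apply: (le_trans (nr_ge0 (f 0))); apply: ub_le_sup => //.
by exists 0 => //=; rewrite normr0.
Qed.

Lemma nr_opnorm (V W : normedModType R[i]) (f : V -> W) x :
  bounded_linear f -> nr (f x) <= opnorm f * nr x.
Proof.
move=> fb; have [lf _] := fb; have [_ ub] := opnorm_has_sup fb.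
have [->|x0] := eqVneq x 0; first by rewrite linear_fun0// !nr0 mulr0.
have nx := nr_gt0 x0; rewrite -ler_pdivrMr//.
have -> : nr (f x) / nr x = complex.Re `|f ((nr x)^-1%:C *: x)|.
  rewrite linear_funZ// -[RHS]/(nr _) nrZr ger0_norm ?invr_ge0 ?(ltW nx)//.
  by rewrite mulrC.
apply: ub_le_sup => //; exists ((nr x)^-1%:C *: x) => //=.
rewrite nrE nrZr ger0_norm ?invr_ge0 ?(ltW nx)// mulVf ?gt_eqF//.
Qed.

Lemma opnorm_le (V W : normedModType R[i]) (f : V -> W) (M : R) :
  0 <= M -> (forall x, nr (f x) <= M * nr x) -> opnorm f <= M.
Proof.
move=> M0 fM; apply: ge_sup.
  by exists (complex.Re `|f 0|), 0 => //=; rewrite normr0.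
move=> _ [x /= x1 <-]; rewrite (le_trans (fM x))// ler_piMr//.
by rewrite -lecR -nrE.
Qed.

End OperatorNorms.

(** * Orthonormal bases for finite rank projections *)

Section Hilbert.
Context {R : realType} {H : hilbertType R[i]}.
Implicit Types x y z : H.

Lemma innerD x y z : inner (x + y) z = inner x z + inner y z.
Proof. by have := inner_linear z 1 x y; rewrite scale1r mul1r. Qed.

Lemma innerZ k x z : inner (k *: x) z = k * inner x z.
Proof.
have i0 : inner 0 z = 0.
  by have := inner_linear z (-1) 0 0; rewrite scaler0 add0r mulN1r addNr.
by have := inner_linear z k x 0; rewrite !addr0 i0 addr0.
Qed.

Lemma inner0 z : inner 0 z = 0.
Proof. by have := innerZ 0 0 z; rewrite scale0r mul0r. Qed.

Lemma innerN x z : inner (- x) z = - inner x z.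
Proof. by rewrite -scaleN1r innerZ mulN1r. Qed.

Lemma innerB x y z : inner (x - y) z = inner x z - inner y z.
Proof. by rewrite innerD innerN. Qed.

Lemma inner_suml (I : Type) (r : seq I) (P : pred I) (F : I -> H) z :
  inner (\sum_(i <- r | P i) F i) z = \sum_(i <- r | P i) inner (F i) z.
Proof. by elim/big_rec2: _ => [|i x y _ <-]; rewrite ?inner0 ?innerD. Qed.

Lemma inner_conjr x y : Num.conj (inner x y) = inner y x.
Proof. by rewrite -inner_conj. Qed.

Lemma innerDr x y z : inner z (x + y) = inner z x + inner z y.
Proof. by rewrite inner_conj innerD rmorphD/= !inner_conjr. Qed.

Lemma innerZr k x z : inner z (k *: x) = Num.conj k * inner z x.
Proof. by rewrite inner_conj innerZ rmorphM/= inner_conjr. Qed.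

Lemma inner0r z : inner z 0 = 0.
Proof. by rewrite inner_conj inner0 rmorph0. Qed.

Lemma innerBr x y z : inner z (x - y) = inner z x - inner z y.
Proof. by rewrite innerDr -scaleN1r innerZr rmorphN rmorph1 mulN1r. Qed.

Lemma inner_nr x : inner x x = (nr x ^+ 2)%:C.
Proof. by rewrite inner_norm nrE rmorphXn. Qed.

(** With c the inner product, |x - c y|^2 = |x|^2 - |c|^2 is nonnegative. *)
Lemma inner_unit_le x y : nr y = 1 -> complex.Re `|inner x y| <= nr x.
Proof.
move=> y1; set c := inner x y.
have cR : `|c| = (complex.Re `|c|)%:C by rewrite RRe_real// ger0_real.
have := inner_nr (x - c *: y).
rewrite innerB !innerBr !innerZ !innerZr (inner_nr y) y1 expr1n rmorph1 mulr1.
rewrite -/c -(inner_conjr x y) -/c subrr subr0 inner_nr -mulrC.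
have -> : c * Num.conj c = ((complex.Re `|c|) ^+ 2)%:C.
  by rewrite -normCK cR rmorphXn.
rewrite -rmorphB => /complexI h.
rewrite -(@ler_pXn2r _ 2) ?nnegrE ?nr_ge0//; last first.
  by rewrite -lecR -cR normr_ge0.
by rewrite -subr_ge0 h exprn_ge0// nr_ge0.
Qed.

Definition orthonormal_seq (xi : nat -> H) k :=
  forall i j, (i < k)%N -> (j < k)%N -> inner (xi i) (xi j) = (i == j)%:R.

Definition span_proj (xi : nat -> H) k x : H := \sum_(i < k) inner x (xi i) *: xi i.

Lemma nr_orthonormal xi k i : orthonormal_seq xi k -> (i < k)%N -> nr (xi i) = 1.
Proof.
move=> o ik; have := o _ _ ik ik; rewrite eqxx inner_nr => /complexI h.
by apply/eqP; rewrite -(@eqrXn2 _ 2) ?nr_ge0// h expr1n.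
Qed.

Lemma inner_span_proj xi k x j : orthonormal_seq xi k -> (j < k)%N ->
  inner (span_proj xi k x) (xi j) = inner x (xi j).
Proof.
move=> o jk; rewrite inner_suml (bigD1 (Ordinal jk))//= innerZ o// eqxx mulr1.
rewrite big1 ?addr0// => i ij; rewrite innerZ o//.
by rewrite (_ : (i == j :> nat) = false) ?mulr0//; exact: negbTE.
Qed.

Lemma inner_span_projC xi k x y :
  inner (span_proj xi k x) y = inner x (span_proj xi k y).
Proof.
rewrite inner_suml inner_conj inner_suml rmorph_sum; apply: eq_bigr => i _.
by rewrite /= !innerZ rmorphM/= !inner_conjr mulrC.
Qed.

Lemma nr_span_coords xi k x : orthonormal_seq xi k ->
  \sum_(i < k) inner x (xi i) * Num.conj (inner x (xi i)) =
    (nr (span_proj xi k x) ^+ 2)%:C.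
Proof.
move=> o; rewrite -inner_nr {1}/span_proj inner_suml; apply: eq_bigr => i _.
by rewrite innerZ -(inner_span_proj x o (ltn_ord i)) inner_conjr.
Qed.

(** Gram-Schmidt, keeping the invariant that every basis vector is fixed by p; a vector already in
    the span adds nothing. *)
Lemma exists_orthonormal (p : H -> H) (s : seq H) : linear p ->
  (forall x, x \in s -> p x = x) ->
  exists xi k, [/\ orthonormal_seq xi k, forall i, (i < k)%N -> p (xi i) = xi i
    & forall x, x \in s -> span_proj xi k x = x].
Proof.
move=> lp; have p0 := linear_fun0 lp.
have pZ k y := linear_funZ k y lp; have pB := linear_funB lp.
elim: s => [|v s IH] ps; first by exists (fun=> 0), 0%N.
have [|xi [k [ho pxi hs]]] := IH; first by move=> x xs; apply: ps; rewrite inE xs orbT.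
pose u := v - span_proj xi k v.
have pP x : p (span_proj xi k x) = span_proj xi k x.
  rewrite /span_proj; elim/big_ind: _ => [//|a b pa pb|i _].
    by rewrite linear_funD// pa pb.
  by rewrite pZ pxi.
have pu : p u = u by rewrite pB ps ?inE ?eqxx// pP.
have ou j : (j < k)%N -> inner u (xi j) = 0.
  by move=> jk; rewrite innerB (inner_span_proj _ ho)// subrr.
have [u0|u0] := eqVneq u 0.
  exists xi, k; split=> // x; rewrite inE => /predU1P[->|/hs//].
  by apply/esym/eqP; rewrite -subr_eq0 -/u u0.
have nu := nr_gt0 u0.
pose w := (nr u)^-1%:C *: u.
have w1 : nr w = 1.
  by rewrite nrZr ger0_norm ?invr_ge0 ?(ltW nu)// mulVf ?gt_eqF.
have ow j : (j < k)%N -> inner w (xi j) = 0 by move=> jk; rewrite innerZ ou ?mulr0.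
pose xi' i := if (i < k)%N then xi i else w.
have xik : xi' k = w by rewrite /xi' ltnn.
have spE x : span_proj xi' k.+1 x = span_proj xi k x + inner x w *: w.
  rewrite /span_proj big_ord_recr/= xik; congr (_ + _).
  by apply: eq_bigr => i _; rewrite /xi' ltn_ord.
exists xi', k.+1; split.
- move=> i j; rewrite !ltnS /xi' => ik jk.
  have [ik'|ki] := ltnP i k; have [jk'|kj] := ltnP j k.
  + exact: ho.
  + rewrite inner_conj ow// rmorph0 (_ : (i == j) = false)//.
    by apply/ltn_eqF/(leq_trans ik').
  + by rewrite ow// (_ : (i == j) = false)//; apply/gtn_eqF/(leq_trans jk').
  + have -> : i = j by apply/eqP; rewrite eqn_leq (leq_trans ik kj) (leq_trans jk ki).
    by rewrite eqxx inner_nr w1 expr1n.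
- by move=> i _; rewrite /xi'; case: ifP => [/pxi//|_]; rewrite pZ pu.
move=> x; rewrite inE spE => /predU1P[->|xs].
  have -> : inner v w = (nr u)%:C.
    have -> : v = u + span_proj xi k v by rewrite /u subrK.
    rewrite innerD inner_span_projC.
    have -> : span_proj xi k w = 0.
      by rewrite /span_proj big1// => i _; rewrite ow// scale0r.
    rewrite inner0r addr0 /w innerZr inner_nr conj_Creal ?complex_real//.
    by rewrite -rmorphM/=; congr (_ %:C); rewrite expr2 mulrA mulVf ?mul1r ?gt_eqF.
  rewrite /w scalerA -rmorphM/= mulfV ?gt_eqF// scale1r.
  by rewrite /u addrC subrK.
have -> : inner x w = 0.
  rewrite -(hs _ xs) inner_span_projC.
  rewrite (_ : span_proj xi k w = 0) ?inner0r//.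
  by rewrite /span_proj big1// => i _; rewrite ow// scale0r.
by rewrite scale0r addr0 hs.
Qed.

(** The v i that witness finite rank may lie outside the range of p. Since p x = p (p x), the p (v
    i) span the range as well, and the basis is built from them. *)
Lemma finite_rank_projection_basis (p : H -> H) :
  orthogonal_projection p -> finite_rank p ->
  exists xi k, orthonormal_seq xi k /\ forall x, p x = span_proj xi k x.
Proof.
move=> [[lp _] pp pC] [n [v hv]].
have [|xi [k [ho pxi hs]]] := @exists_orthonormal p [seq p (v i) | i <- enum 'I_n] lp.
  by move=> x /mapP[i _ ->].
exists xi, k; split=> // x.
have -> : span_proj xi k x = span_proj xi k (p x).
  by apply: eq_bigr => i _; rewrite pC pxi.
have sp0 : span_proj xi k 0 = 0.
  by rewrite /span_proj big1// => i _; rewrite inner0 scale0r.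
have spD a b : span_proj xi k (a + b) = span_proj xi k a + span_proj xi k b.
  by rewrite /span_proj -big_split; apply: eq_bigr => i _; rewrite innerD scalerDl.
have spZ c y : span_proj xi k (c *: y) = c *: span_proj xi k y.
  by rewrite /span_proj scaler_sumr; apply: eq_bigr => i _; rewrite innerZ scalerA.
have [c xc] := hv x; rewrite -pp xc.
elim/big_ind: _ => [|a b ha hb|i _]; first by rewrite linear_fun0// sp0.
  by rewrite linear_funD// spD -ha -hb.
by rewrite linear_funZ// spZ hs//; apply: map_f; rewrite mem_enum.
Qed.

Lemma nr_orthogonal_projection (p : H -> H) x :
  orthogonal_projection p -> nr (p x) <= nr x.
Proof.
move=> [[lp _] pp pC].
rewrite -(@ler_pXn2r _ 2) ?nnegrE ?nr_ge0// -subr_ge0.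
have : ((nr x ^+ 2 - nr (p x) ^+ 2)%:C = (nr (x - p x) ^+ 2)%:C :> R[i]).
  have e : inner (p x) (p x) = inner x (p x) by rewrite pC pp.
  by rewrite rmorphB/= -!inner_nr innerB !innerBr e (pC x x) subrr subr0.
by move=> /complexI ->; rewrite exprn_ge0// nr_ge0.
Qed.

End Hilbert.

(** * Rank one operators *)

Section RankOne.
Context {R : realType} {H : hilbertType R[i]}.
Implicit Types x y z : H.

Lemma inner_le x y : complex.Re `|inner x y| <= nr x * nr y.
Proof.
have [->|y0] := eqVneq y 0; first by rewrite inner0r normr0 nr0 mulr0.
have ny := nr_gt0 y0; pose w := (nr y)^-1%:C *: y.
have w1 : nr w = 1.
  by rewrite nrZr ger0_norm ?invr_ge0 ?(ltW ny)// mulVf ?gt_eqF.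
have -> : y = (nr y)%:C *: w.
  by rewrite scalerA -rmorphM/= mulfV ?gt_eqF// scale1r.
rewrite nrZr w1 mulr1 (ger0_norm (ltW ny)) innerZr conj_Creal ?complex_real//.
have -> : `|(nr y)%:C * inner x w| = (nr y)%:C * `|inner x w|.
  by rewrite normrM; congr (_ * _); rewrite ger0_norm// lecR ltW.
have cR : `|inner x w| = (complex.Re `|inner x w|)%:C by rewrite RRe_real// ger0_real.
by rewrite cR -rmorphM/= mulrC ler_wpM2r ?(ltW ny)// inner_unit_le.
Qed.

Lemma rank_one_bounded x : bounded_linear (fun y => inner y x *: x).
Proof.
split; first by move=> k y z; rewrite innerD innerZ scalerDl scalerA.
exists (nr x ^+ 2)%:C => y; rewrite nrE (nrE y) -rmorphM/= lecR nrZ.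
by rewrite expr2 mulrAC ler_wpM2r ?nr_ge0// mulrC inner_le.
Qed.

Lemma scaler_real_continuous y : continuous (fun r : R => r%:C *: y).
Proof.
move=> r; apply/cvgrPdist_lt => e e0.
have eR : e = (complex.Re e)%:C by rewrite RRe_real// gtr0_real.
have e0' : 0 < complex.Re e by rewrite -ltcR -eR.
have y0 : 0 < nr y + 1 by have := nr_ge0 y; lra.
apply/nbhs_ballP; exists (complex.Re e / (nr y + 1)); first exact: divr_gt0.
move=> t /=; rewrite /ball/= ltr_pdivlMr// => rt.
rewrite -scalerBl -rmorphB/= nrE eR ltcR nrZr; apply: le_lt_trans rt.
by rewrite ler_wpM2l// lerDl.
Qed.

(** The unit ball is sent into the set of all (a + i b) x with |a| and |b| at most |x|, a continuous
    image of a square in the plane. *)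
Lemma rank_one_compact x : compact_operator (fun y => inner y x *: x).
Proof.
split; first exact: rank_one_bounded.
pose F (p : R * R) : H := p.1%:C *: x + p.2%:C *: ('i *: x).
pose K := F @` (`[- nr x, nr x] `*` `[- nr x, nr x]).
have Fc : continuous F.
  move=> p; apply: cvgD.
    apply: (@continuous_comp _ _ _ fst (fun r : R => r%:C *: x)); first exact: cvg_fst.
    exact: scaler_real_continuous.
  apply: (@continuous_comp _ _ _ snd (fun r : R => r%:C *: ('i *: x))).
    exact: cvg_snd.
  exact: scaler_real_continuous.
have Kc : compact K.
  apply: continuous_compact; first exact: continuous_subspaceT.
  by apply: compact_setX; exact: segment_compact.
apply: (subclosed_compact _ Kc); first exact: closed_closure.
have -> : K = closure K.
  by apply/closure_id; exact: compact_closed (@norm_hausdorff _ _) Kc.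
apply: closureS => _ [y /= y1 <-]; set c := inner y x.
have cx : complex.Re `|c| <= nr x.
  rewrite (le_trans (inner_le _ _))// ler_piMl ?nr_ge0//.
  by rewrite -lecR -nrE.
have cR : `|c| = (complex.Re `|c|)%:C by rewrite RRe_real// ger0_real.
exists (complex.Re c, complex.Im c).
  split; rewrite /= in_itv /= -ler_norml (le_trans _ cx)// -lecR -cR.
    exact: normc_ge_Re.
  by rewrite normc_def lecR -sqrtr_sqr ler_wsqrtr// lerDr sqr_ge0.
rewrite /F /= scalerA -scalerDl; congr (_ *: _).
by rewrite [RHS]complexE mulrC.
Qed.
End RankOne.

(** * Compressed operators written in matrix units *)

Section Blocks.
Context {R : realType} {H : hilbertType R[i]} {C : cstarAlgType R[i]}.
Variables (xi : nat -> H) (k : nat) (v : nat -> C) (s q : C).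
Hypothesis xi_on : orthonormal_seq xi k.
Hypothesis s_proj : projection s.
Hypothesis s_neq0 : s != 0.
Hypothesis q_proj : projection q.
Hypothesis v_corner : forall i, (i < k)%N -> q ** v i = v i.
Hypothesis v_isom : forall i j, (i < k)%N -> (j < k)%N ->
  star (v i) ** v j = if i == j then s else 0.
Implicit Types (x y : H) (T S : H -> H).

Local Notation P := (span_proj xi k).

(* The isometry from the span of the [xi i] onto a column of matrix units,
   and the representation of operators by these matrix units. *)
Definition column x : C := \sum_(i < k) inner x (xi i) *: v i.

Definition block T : C := \sum_(j < k) column (T (xi j)) ** star (v j).

Lemma span_proj_linear : linear P.
Proof.
move=> c x y; rewrite /span_proj scaler_sumr -big_split; apply: eq_bigr => i _.
by rewrite innerD innerZ scalerDl scalerA.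
Qed.

Lemma span_projK x : P (P x) = P x.
Proof. by apply: eq_bigr => i _; rewrite (inner_span_proj _ xi_on). Qed.

Lemma span_proj_xi i : (i < k)%N -> P (xi i) = xi i.
Proof.
move=> ik; rewrite /span_proj (bigD1 (Ordinal ik))//= xi_on// eqxx scale1r.
rewrite big1 ?addr0// => j ji; rewrite xi_on// (_ : (i == j :> nat) = false).
  by rewrite scale0r.
by rewrite eq_sym; exact: negbTE.
Qed.

Lemma column_linear : linear column.
Proof.
move=> c x y; rewrite /column scaler_sumr -big_split; apply: eq_bigr => i _.
by rewrite innerD innerZ scalerDl scalerA.
Qed.

Lemma isometry_right i : (i < k)%N -> v i ** s = v i.
Proof.
have [ss s2] := s_proj; move=> ik; apply/esym/eqP; rewrite -subr_eq0; apply/eqP.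
apply: starM0; rewrite starB starM ss.
transitivity (star (v i) ** v i - star (v i) ** v i ** s - s ** (star (v i) ** v i)
  + s ** (star (v i) ** v i) ** s); first by nc.
by rewrite v_isom// eqxx !s2; nc.
Qed.

Lemma star_isometry_column j x : (j < k)%N ->
  star (v j) ** column x = inner x (xi j) *: s.
Proof.
move=> jk; rewrite amul_sumr (bigD1 (Ordinal jk))//= amulZr v_isom// eqxx.
rewrite big1 ?addr0// => i ij; rewrite amulZr v_isom// (_ : (j == i :> nat) = false).
  by rewrite scaler0.
by rewrite eq_sym; exact: negbTE.
Qed.

Lemma column_right x : column x ** s = column x.
Proof. by rewrite amul_suml; apply: eq_bigr => i _; rewrite amulZl isometry_right. Qed.

(** Here [star (column x) ** column x] is |P x|^2 s, and the nonzero projection s has norm 1. *)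
Lemma nr_column x : nr (column x) = nr (P x).
Proof.
apply/eqP; rewrite -(@eqrXn2 _ 2) ?nr_ge0//; apply/eqP.
rewrite -nr_starM {1}/column star_sum amul_suml.
under eq_bigr => i _ do rewrite starZ amulZl star_isometry_column// scalerA.
rewrite -scaler_suml; have -> : \sum_(i < k) Num.conj (inner x (xi i)) * inner x (xi i)
   = (nr (P x) ^+ 2)%:C.
  by rewrite -nr_span_coords//; apply: eq_bigr => i _; rewrite mulrC.
by rewrite nrZr nr_proj// mulr1 ger0_norm// exprn_ge0// nr_ge0.
Qed.

Lemma block_column T x : linear T -> block T ** column x = column (T (P x)).
Proof.
move=> lT; rewrite amul_suml.
under eq_bigr => j _ do
  rewrite -amulA star_isometry_column// amulZr column_right.
have [c0 cD] := (linear_fun0 column_linear, linear_funD column_linear).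
rewrite /span_proj; set F := fun y => column (T y).
have FD : {morph F : a b / a + b}.
  by move=> a b; rewrite /F (linear_funD lT) cD.
have F0 : F 0 = 0 by rewrite /F (linear_fun0 lT).
rewrite -/(F _) (big_morph F FD F0); apply: eq_bigr => j _.
by rewrite /F (linear_funZ _ _ lT) (linear_funZ _ _ column_linear).
Qed.

Lemma block_mul S T : linear S -> block S ** block T = block (fun x => S (P (T x))).
Proof.
move=> lS; rewrite {2}/block amul_sumr; apply: eq_bigr => j _.
by rewrite amulA block_column.
Qed.

Lemma block_star T T' : (forall x y, inner (T x) y = inner x (T' y)) ->
  star (block T) = block T'.
Proof.
move=> TT'; rewrite star_sum /block.
under eq_bigr => j _ do rewrite starM starK /column star_sum amul_sumr.
under [RHS]eq_bigr => j _ do rewrite /column amul_suml.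
rewrite exchange_big; apply: eq_bigr => i _; apply: eq_bigr => j _.
by rewrite starZ amulZr amulZl TT' inner_conjr.
Qed.

Lemma nr_isometry i : (i < k)%N -> nr (v i) = 1.
Proof.
move=> ik; apply/eqP; rewrite -(@eqrXn2 _ 2) ?nr_ge0// -nr_starM v_isom// eqxx.
by rewrite nr_proj// expr1n.
Qed.

Lemma nr_block_crude T (M : R) : (forall x, nr (P (T (P x))) <= M * nr x) ->
  nr (block T) <= k%:R * M.
Proof.
move=> hT; rewrite (le_trans (nr_sum _ _ _))//.
have -> : k%:R * M = \sum_(i < k) M by rewrite sumr_const card_ord mulr_natl.
apply: ler_sum => j _; have := hT (xi j).
rewrite span_proj_xi// (nr_orthonormal xi_on)// mulr1 -nr_column => h.
have := nrM (column (T (xi j))) (star (v j)).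
by rewrite nr_star nr_isometry// mulr1 => /le_trans; apply.
Qed.

(* The crude bound is made sharp by applying it to the iterated squares of
   [star (block T) ** block T]. *)
Lemma nr_block T T' (M : R) : 0 <= M -> linear T -> linear T' ->
  (forall x y, inner (T x) y = inner x (T' y)) ->
  (forall x, nr (P (T (P x))) <= M * nr x) ->
  (forall x, nr (P (T' (P x))) <= M * nr x) -> nr (block T) <= M.
Proof.
move=> M0 lT lT' TT' hT hT'; rewrite -(@ler_pXn2r _ 2) ?nnegrE ?nr_ge0//.
rewrite -nr_starM; set h := _ ** _.
have lP := span_proj_linear.
(* Operators whose blocks are the iterated squares of h; by [block_mul] each product inserts a [P]
   between the factors. *)
pose W := fix W n := if n is n'.+1 then fun x => W n' (P (W n' x))
  else fun x => T' (P (T x)).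
have lW n : linear (W n).
  elim: n => [|n IH] c x y /=; first by rewrite lT lP lT'.
  by rewrite IH lP IH.
have hW n : isq h n = block (W n).
  elim: n => [|n IH] /=; first by rewrite /h (block_star TT') block_mul.
  by rewrite IH block_mul.
have nW n x : nr (P (W n (P x))) <= (M ^+ 2) ^+ (2 ^ n) * nr x.
  elim: n x => [|n IH] x /=.
    rewrite -[P (T (P x))]span_projK (le_trans (hT' _))// expr1 expr2 -mulrA ler_wpM2l//.
  rewrite -[P (W n (P x))]span_projK (le_trans (IH _))//.
  rewrite expnS mul2n -addnn exprD -mulrA ler_wpM2l ?IH//.
  by rewrite !exprn_ge0.
apply: (@root_bound _ _ _ k%:R 0) => [||n]; rewrite ?nr_ge0 ?exprn_ge0//.
rewrite mul0r addr0 -nr_isq ?starM ?starK// hW; exact: nr_block_crude.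
Qed.

(** Left multiplication by [block T] acts on columns as the compression of T, and columns are
    isometric on the span. Injectivity of the extension rests on this. *)
Lemma block_lower_bound T x : linear T ->
  nr (P (T (P x))) <= nr (block T) * nr (P x).
Proof. by move=> lT; rewrite -!nr_column -block_column// nrM. Qed.

Lemma block_corner T : q ** block T = block T /\ block T ** q = block T.
Proof.
have [qs qq] := q_proj; split.
  rewrite amul_sumr; apply: eq_bigr => j _; rewrite amulA; congr (_ ** _).
  by rewrite amul_sumr; apply: eq_bigr => i _; rewrite amulZr v_corner.
rewrite amul_suml; apply: eq_bigr => j _; rewrite -amulA; congr (_ ** _).
by rewrite -{1}qs -starM v_corner.
Qed.

Lemma block_lin (c : R[i]) S T :
  block (fun x => c *: S x + T x) = c *: block S + block T.
Proof.
rewrite /block scaler_sumr -big_split; apply: eq_bigr => j _.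
by rewrite column_linear amulDl amulZl.
Qed.

End Blocks.

(** * Asymptotically multiplicative blocks from quasidiagonality *)

Section QuasidiagonalBlocks.
Context {R : realType}.

Lemma bounded_linearB (V W : normedModType R[i]) (f g : V -> W) :
  bounded_linear f -> bounded_linear g -> bounded_linear (fun x => f x - g x).
Proof.
move=> hf hg; rewrite (_ : (fun x => _) = (fun x => (-1) *: g x + f x)).
  exact: bounded_linear_lin.
by apply/funext => x; rewrite scaleN1r addrC.
Qed.

Lemma opnorm_cvg0 (V W : normedModType R[i]) (f : nat -> V -> W) :
  (forall n, bounded_linear (f n)) -> opnorm (f n) @[n --> \oo] --> 0 ->
  forall e : R, 0 < e -> exists N, forall n, (N <= n)%N ->
    forall x, nr (f n x) <= e * nr x.
Proof.
move=> fb f0 e e0; have [N _ hN] := (cvgrPdist_lt _ _).1 f0 _ e0.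
exists N => n Nn x; rewrite (le_trans (nr_opnorm x (fb n)))// ler_wpM2r ?nr_ge0//.
have := hN n Nn; rewrite /= sub0r normrN => h.
by rewrite (le_trans (ler_norm _))// ltW.
Qed.

(** The hypothesis concerns compact operators. Applied to the rank one operator of x and evaluated
    at x itself, it controls |x|^2 (p n x - x). *)
Lemma finite_rank_approximate_identity_cvs (H : hilbertType R[i])
    (p : nat -> H -> H) x :
  finite_rank_approximate_identity p -> cvs (fun n => p n x) x.
Proof.
move=> [hp _ hT]; have [h1 _] := hT _ (rank_one_compact x).
have pb n : bounded_linear (p n) by have [[]] := hp n.
have [->|x0] := eqVneq x 0.
  apply: (eq_cvs (u := fun=> 0)); last exact: cvs_cst.
  by exists 0%N => n _; have [/linear_fun0 ->] := pb n.
have nx := nr_gt0 x0.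
have hb n : bounded_linear (fun y => p n (inner y x *: x) - inner y x *: x).
  apply: bounded_linearB; last exact: rank_one_bounded.
  exact: bounded_linear_comp (rank_one_bounded x) (pb n).
move=> e e0; have e2 : 0 < e * nr x / 2 by rewrite divr_gt0// mulr_gt0.
have [N hN] := opnorm_cvg0 hb h1 e2; exists N => n /hN /(_ x).
have [lp _] := pb n.
rewrite inner_nr linear_funZ// -scalerBr nrZr ger0_norm ?exprn_ge0 ?nr_ge0//.
have -> : e * nr x / 2 * nr x = nr x ^+ 2 * (e / 2) by ring.
rewrite ler_pM2l ?exprn_gt0// => h; apply: le_lt_trans h _.
by rewrite ltr_pdivrMr// ltr_pMr// ltr1n.
Qed.

(** The uniform bound serves strict convergence of the sum of the blocks, the vanishing defect its
    multiplicativity modulo [C], and the last clause its injectivity modulo [C]. *)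
Lemma exists_asymptotic_blocks (A C : cstarAlgType R[i]) : quasidiagonal A ->
  ~ unital C -> sigma_unital C -> has_projection_approximate_identity C ->
  simple C -> property_SP C ->
  exists (g : nat -> C) (psi : nat -> A -> C),
    approximate_unit g /\
    [/\ forall n k a b, psi n (k *: a + b) = k *: psi n a + psi n b,
        forall n a, star (psi n a) = psi n (star a),
        forall n a, in_corner (g n.+1 - g n) (psi n a)
      & [/\ forall a, exists2 M : R, 0 <= M & forall n, nr (psi n a) <= M,
            forall a b, cvs (fun n => psi n (a ** b) - psi n a ** psi n b) 0
          & forall a, cvs (fun n => psi n a) 0 -> a = 0]].
Proof.
move=> [H [phi [p [_ [phib philin phiM phistar] phiinj pai pcomm]]]] Cnu Csu hC Cs SP.
have [hp _ _] := pai.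
have /choice[B hB] : forall n, exists B : (nat -> H) * nat,
    orthonormal_seq B.1 B.2 /\ forall x, p n x = span_proj B.1 B.2 x.
  move=> n; have [op fr] := hp n.
  by have [xi [k ?]] := finite_rank_projection_basis op fr; exists (xi, k).
have [g [s [v [gP hv]]]] :=
  exists_block_structure (fun n => (B n).2) Cnu Csu hC Cs SP.
pose psi n a := block (B n).1 (B n).2 (v n) (phi a).
have on n : orthonormal_seq (B n).1 (B n).2 by case: (hB n).
have sp n : projection (s n) by case: (hv n).
have s0 n : s n != 0 by case: (hv n).
have vi n i j : (i < (B n).2)%N -> (j < (B n).2)%N ->
    star (v n i) ** v n j = if i == j then s n else 0.
  by move=> /ltnW ik /ltnW jk; case: (hv n) => _ _ _; apply.
have pE n x : p n x = span_proj (B n).1 (B n).2 x by case: (hB n).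
have plin n : linear (p n) by have [[[]]] := hp n.
have p1 n x : nr (p n x) <= nr x.
  by apply: nr_orthogonal_projection; case: (hp n).
have ppE n x : p n (p n x) = p n x by have [[]] := hp n.
have pC n x y : inner (p n x) y = inner x (p n y) by have [[]] := hp n.
have lphi a : linear (phi a) by case: (phib a).
have blockM n T T' (M : R) : 0 <= M -> linear T -> linear T' ->
    (forall x y, inner (T x) y = inner x (T' y)) ->
    (forall x, nr (T (p n x)) <= M * nr x) ->
    (forall x, nr (T' (p n x)) <= M * nr x) ->
    nr (block (B n).1 (B n).2 (v n) T) <= M.
  move=> M0 lT lT' TT' h h'.
  apply: (nr_block (on n) (sp n) (s0 n) (vi n) M0 lT lT' TT') => x.
    by rewrite -!pE (le_trans (p1 _ _)).
  by rewrite -!pE (le_trans (p1 _ _)).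
have phic a : exists2 M : R, 0 <= M & forall x, nr (phi a x) <= M * nr x.
  exact: bounded_linear_nr.
exists g, psi; split=> //; split=> [n k a b|n a|n a|].
- rewrite -block_lin; congr (block _ _ _ _); apply/funext => x.
  exact: philin.
- exact: block_star.
- have [qs qq] := approximate_unit_gap_projection gP (leqnSn n).
  apply: block_corner => // i /ltnW ik; case: (hv n) => _ _ h _; exact: h.
split=> [a|a b|a psi0].
- have [M M0 hM] := phic a; have [M' M'0 hM'] := phic (star a).
  (* [nr_block] asks for one bound valid for the operator and its adjoint. *)
  exists (M + M') => [|n]; first exact: addr_ge0.
  apply: (blockM n _ (phi (star a))) => //[|x|x]; first exact: addr_ge0.
    by rewrite (le_trans (hM _))// ler_pM ?nr_ge0 ?p1 ?lerDl.
  by rewrite (le_trans (hM' _))// ler_pM ?nr_ge0 ?p1 ?lerDr.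
- have [M M0 hM] := phic a; have [M' M'0 hM'] := phic (star b).
  have comm c : forall e : R, 0 < e -> exists N, forall n, (N <= n)%N ->
      forall x, nr (p n (phi c x) - phi c (p n x)) <= e * nr x.
    apply: (opnorm_cvg0 _ (pcomm c)) => n.
    have pb : bounded_linear (p n) by have [[]] := hp n.
    by apply: bounded_linearB; apply: bounded_linear_comp.
  move=> e e0; have K0 : 0 < M + M' + 1 by lra.
  have d0 := divr_gt0 e0 K0; set d := e / _ in d0.
  have [N1 h1] := comm b _ d0; have [N2 h2] := comm (star a) _ d0.
  exists (maxn N1 N2) => n; rewrite geq_max subr0 => /andP[/h1 {}h1 /h2 {}h2].
  apply: (@le_lt_trans _ _ ((M + M') * d)); last first.
    have -> : e = (M + M' + 1) * d by rewrite /d mulrC divfK// gt_eqF.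
    by rewrite ltr_pM2r// ltrDl.
  (* The defect is the block of phi a (1 - p n) phi b, and the adjoint of D a b is D b^* a^*. On the
     range of p n, (1 - p n) phi c' is a commutator with p n, hence small; this is needed for b and
     for a^*. *)
  pose D c c' x := phi c (phi c' x - p n (phi c' x)).
  have -> : psi n (a ** b) - psi n a ** psi n b =
      block (B n).1 (B n).2 (v n) (D a b).
    rewrite /psi (block_mul _ (sp n) (vi n))// addrC -scaleN1r -block_lin.
    congr (block _ _ _ _); apply/funext => x.
    by rewrite /D linear_funB// phiM -pE scaleN1r addrC.
  have lD c c' : linear (D c c').
    by move=> k x y; rewrite /D !lphi plin opprD addrACA -scalerBr lphi.
  have hD c c' (m : R) : 0 <= m -> (forall x, nr (phi c x) <= m * nr x) ->
      (forall x, nr (p n (phi c' x) - phi c' (p n x)) <= d * nr x) ->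
      m <= M + M' -> forall x, nr (D c c' (p n x)) <= (M + M') * d * nr x.
    move=> m0 hm hc mM x; rewrite (le_trans (hm _))// -mulrA.
    apply: ler_pM => //; rewrite ?nr_ge0// nrBC -{2}(ppE n x).
    by rewrite (le_trans (hc _))// ler_pM2l.
  apply: (blockM n _ (D (star b) (star a))) => //.
  + by rewrite mulr_ge0 ?addr_ge0// ltW.
  + by move=> x y; rewrite /D phistar innerB pC -innerBr phistar.
  + by apply: (hD _ _ M) => //; rewrite lerDl.
  + by apply: (hD _ _ M') => //; rewrite lerDr.
have phi0 x : phi 0 x = 0.
  by have := philin (-1) 0 0 x; rewrite scaler0 add0r scaleN1r addNr.
apply: phiinj; apply/funext => x; rewrite phi0; apply: contrapT => /eqP y0.
have ny := nr_gt0 y0; have [M M0 hM] := phic a.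
have px := finite_rank_approximate_identity_cvs x pai.
have py := finite_rank_approximate_identity_cvs (phi a x) pai.
(* Three errors of at most a quarter of |phi a x| each contradict phi a x <> 0: from p n (phi a x),
   from replacing x by p n x, and from the block norm. The added 1's avoid zero denominators. *)
have d1 : 0 < nr (phi a x) / 4 / (M + 1) by rewrite !divr_gt0//; lra.
have d2 : 0 < nr (phi a x) / 4 by rewrite divr_gt0.
have d3 : 0 < nr (phi a x) / 4 / (nr x + 1).
  by rewrite !divr_gt0//; have := nr_ge0 x; lra.
have [N1 h1] := px _ d1; have [N2 h2] := py _ d2; have [N3 h3] := psi0 _ d3.
pose n := maxn N1 (maxn N2 N3).
have {}h1 : nr (p n x - x) < nr (phi a x) / 4 / (M + 1) by apply: h1; exact: leq_maxl.
have {}h2 : nr (p n (phi a x) - phi a x) < nr (phi a x) / 4.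
  by apply: h2; rewrite (leq_trans (leq_maxl N2 N3))// leq_maxr.
have {}h3 : nr (psi n a) < nr (phi a x) / 4 / (nr x + 1).
  by rewrite -[psi n a]subr0; apply: h3; rewrite (leq_trans (leq_maxr N2 N3))// leq_maxr.
have := block_lower_bound (on n) (sp n) (s0 n) (vi n) x (lphi a).
rewrite -!pE -/(psi n a) => h4.
have h5 : nr (psi n a) * nr (p n x) <= nr (phi a x) / 4.
  rewrite (@le_trans _ _ (nr (psi n a) * (nr x + 1)))//.
    by rewrite ler_wpM2l ?nr_ge0// (le_trans (p1 _ _))// lerDl.
  by rewrite -ler_pdivlMr ?(ltW h3)//; have := nr_ge0 x; lra.
have h6 : nr (p n (phi a (p n x)) - p n (phi a x)) <= nr (phi a x) / 4.
  rewrite -linear_funB// -linear_funB// (le_trans (p1 _ _))// (le_trans (hM _))//.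
  rewrite (@le_trans _ _ ((M + 1) * nr (p n x - x)))//.
    by rewrite ler_wpM2r ?nr_ge0// lerDl.
  by rewrite mulrC -ler_pdivlMr ?(ltW h1)//; lra.
have := nr_tri (p n (phi a x)) (p n (phi a (p n x))) (phi a x).
have := nr_tri0 (p n (phi a (p n x))) (phi a x).
rewrite (nrBC (phi a x)); lra.
Qed.

End QuasidiagonalBlocks.

(** * Multipliers as strict limits of block sums *)

Section MultiplierSums.
Context {R : realType} {C : cstarAlgType R[i]}.
Variable g : nat -> C.
Hypothesis gP : approximate_unit g.

(** These are the sequences mu g_n for multipliers mu that commute with every g_n;
    [exists_multiplier] recovers mu. *)
Definition coherent (T : nat -> C) :=
  (exists2 M : R, 0 <= M & forall n, nr (T n) <= M) /\
  forall m n, (m <= n)%N -> T n ** g m = T m /\ g m ** T n = T m.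

(** For n >= N, T n c - T N c = T n (c - g N c), which is small because T is bounded. *)
Lemma coherent_cvs T c : coherent T ->
  (exists l, cvs (fun n => T n ** c) l) /\ (exists l, cvs (fun n => c ** T n) l).
Proof.
move=> [[M M0 TM] Tg]; have [_ _ /(_ c)[c1 c2]] := gP.
have M1 : 0 < M + 1 by lra.
split; apply: nr_complete => e e0.
  have d0 : 0 < e / 2 / (M + 1) by rewrite !divr_gt0.
  have [N /(_ _ (leqnn N)) hN] := c1 _ d0; exists N.
  have h n : (N <= n)%N -> nr (T n ** c - T N ** c) < e / 2.
    move=> Nn; have -> : T n ** c - T N ** c = - (T n ** (g N ** c - c)).
      by rewrite -(proj1 (Tg _ _ Nn)); nc.
    rewrite nrN; have := nrM_le (TM n) (lexx (nr (g N ** c - c))).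
    move: hN; rewrite ltr_pdivlMr//; have := nr_ge0 (g N ** c - c).
    by nra.
  move=> m n Nm Nn; have := h _ Nm; have := h _ Nn.
  have := nr_tri (T N ** c) (T m ** c) (T n ** c); rewrite (nrBC (T N ** c)); lra.
have d0 : 0 < e / 2 / (M + 1) by rewrite !divr_gt0.
have [N /(_ _ (leqnn N)) hN] := c2 _ d0; exists N.
have h n : (N <= n)%N -> nr (c ** T n - c ** T N) < e / 2.
  move=> Nn; have -> : c ** T n - c ** T N = - ((c ** g N - c) ** T n).
    by rewrite -(proj2 (Tg _ _ Nn)); nc.
  rewrite nrN; have := nrM_le (lexx (nr (c ** g N - c))) (TM n).
  move: hN; rewrite ltr_pdivlMr//; have := nr_ge0 (c ** g N - c).
  by nra.
move=> m n Nm Nn; have := h _ Nm; have := h _ Nn.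
have := nr_tri (c ** T N) (c ** T m) (c ** T n); rewrite (nrBC (c ** T N)); lra.
Qed.

Lemma exists_multiplier T : coherent T ->
  exists mu : multiplier C, forall n, lmult mu (g n) = T n /\ rmult mu (g n) = T n.
Proof.
move=> Tc; have [[M M0 TM] Tg] := Tc.
have /choice[L hL] : forall c, exists l, cvs (fun n => T n ** c) l.
  by move=> c; case: (coherent_cvs c Tc).
have /choice[Q hQ] : forall c, exists l, cvs (fun n => c ** T n) l.
  by move=> c; case: (coherent_cvs c Tc).
have dc : is_double_centralizer (L, Q).
  apply/asboolP; split=> /=.
  - split=> [k x y|].
      apply: cvs_uniq (hL _) _.
      apply: (eq_cvs (u := fun n => k *: (T n ** x) + T n ** y)).
        by exists 0%N => n _; rewrite amulDr amulZr.
      by apply: cvsD (hL y); apply: cvsZ.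
    exists M%:C => x; rewrite !nrE -rmorphM lecR -[L x]subr0.
    apply: cvs_bound (hL x) _ => n; rewrite subr0.
    exact: nrM_le.
  - split=> [k x y|].
      apply: cvs_uniq (hQ _) _.
      apply: (eq_cvs (u := fun n => k *: (x ** T n) + y ** T n)).
        by exists 0%N => n _; rewrite amulDl amulZl.
      by apply: cvsD (hQ y); apply: cvsZ.
    exists M%:C => x; rewrite !nrE -rmorphM lecR -[Q x]subr0 mulrC.
    apply: cvs_bound (hQ x) _ => n; rewrite subr0.
    exact: nrM_le.
  - move=> a b; apply: cvs_uniq (hL _) _.
    apply: (eq_cvs (u := fun n => T n ** a ** b)); last exact: cvsMr.
    by exists 0%N => n _; rewrite amulA.
  - move=> a b; apply: cvs_uniq (hQ _) _.
    apply: (eq_cvs (u := fun n => a ** (b ** T n))); last exact: cvsMl.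
    by exists 0%N => n _; rewrite amulA.
  - move=> a b; apply: cvs_uniq (cvsMr b (hQ a)) _.
    apply: (eq_cvs (u := fun n => a ** (T n ** b))); last exact: cvsMl.
    by exists 0%N => n _; rewrite amulA.
exists (Multiplier dc) => m; rewrite /lmult /rmult /=; split.
  apply: cvs_uniq (hL _) _; apply: (eq_cvs (u := fun=> T m)); last exact: cvs_cst.
  by exists m => n /Tg[].
apply: cvs_uniq (hQ _) _; apply: (eq_cvs (u := fun=> T m)); last exact: cvs_cst.
by exists m => n /Tg[].
Qed.

(** By continuity, the left action on c is the limit of its values at g n times c. The difference d
    of the right actions satisfies d b = 0 for all b, in particular for b = [star d]. *)
Lemma multiplier_eq_on (mu nu : multiplier C) :
  (forall n, lmult mu (g n) = lmult nu (g n)) -> mu = nu.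
Proof.
move=> h.
have lcvs (m : multiplier C) c : cvs (fun n => lmult m (g n) ** c) (lmult m c).
  have [/= bL _ LM _ _] := multiplierP m; have [lL _] := bL.
  have [M M0 hM] := bounded_linear_nr bL.
  have [_ _ /(_ c)[c1 _]] := gP.
  apply: (eq_cvs (u := lmult m \o (fun n => g n ** c))).
    by exists 0%N => n _; rewrite /= LM.
  by apply: (cvs_lip (M := M)) c1 => x y; rewrite -linear_funB// hM.
have hl : lmult mu =1 lmult nu.
  move=> c; apply: cvs_uniq (lcvs mu c) _; apply: eq_cvs (lcvs nu c).
  by exists 0%N => n _; rewrite h.
apply: multiplier_eq => // a; apply/eqP; rewrite -subr_eq0; apply/eqP.
set d := rmult mu a - rmult nu a.
have d0 b : d ** b = 0.
  have [/= _ _ _ _ LR] := multiplierP mu; have [/= _ _ _ _ LR'] := multiplierP nu.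
  by rewrite amulBl LR LR' hl subrr.
by rewrite -[d]starK (starM0 (x := star d)) ?star0// starK d0.
Qed.

Definition gap n := g n.+1 - g n.

Lemma gap_projection n : projection (gap n).
Proof. exact: approximate_unit_gap_projection. Qed.

Lemma gap_orthogonal i j x y : in_corner (gap i) x -> in_corner (gap j) y ->
  i != j -> x ** y = 0.
Proof.
move=> [_ <-] [<- _] ij; rewrite amulA -(amulA x).
suff -> : gap i ** gap j = 0 by rewrite amul0r amul0l.
by move: ij; rewrite neq_ltn => /orP[] h;
   have [] := approximate_unit_gap_orthogonal gP (leqnSn _) h (leqnSn _).
Qed.

Section BlockSequence.
Variable b : nat -> C.
Hypothesis b_corner : forall n, in_corner (gap n) (b n).

Local Notation T := (fun n => \sum_(0 <= j < n) b j).

Lemma nr_block_sum (r : seq nat) (M : R) : uniq r -> 0 <= M ->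
  (forall i, i \in r -> nr (b i) <= M) -> nr (\sum_(i <- r) b i) <= M.
Proof.
move=> ur M0 bM; apply: nr_orthogonal_sum => // i j ij.
have si k := in_corner_star (gap_projection k) (b_corner k).
by split; apply: gap_orthogonal ij.
Qed.

Lemma block_sum_mul m n : (m <= n)%N -> T n ** g m = T m /\ g m ** T n = T m.
Proof.
move=> mn.
have bg i : b i ** g m = if (i < m)%N then b i else 0.
  have [_ bE] := b_corner i; rewrite -{1}bE -amulA amulBl !(approximate_unitM gP).
  have [im|mi] := ltnP i m; first by rewrite (minn_idPl im).
  by rewrite (minn_idPr (leqW mi)) subrr amul0r.
have gb i : g m ** b i = if (i < m)%N then b i else 0.
  have [bE _] := b_corner i; rewrite -{1}bE amulA amulBr !(approximate_unitM gP).
  have [im|mi] := ltnP i m; first by rewrite (minn_idPr im).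
  by rewrite (minn_idPl (leqW mi)) subrr amul0l.
rewrite amul_suml amul_sumr (eq_bigr _ (fun i _ => bg i)) (eq_bigr _ (fun i _ => gb i)).
by rewrite -big_mkcond/= [RHS](big_nat_widen _ _ _ _ _ mn).
Qed.

Lemma block_sum_coherent (M : R) : 0 <= M -> (forall n, nr (b n) <= M) -> coherent T.
Proof.
move=> M0 bM; split; last exact: block_sum_mul.
by exists M => // n; apply: nr_block_sum => //; exact: iota_uniq.
Qed.

(** A tail of the sum is only as large as its largest block, so blocks tending to 0 give a norm
    convergent sum without any summability. *)
Lemma block_sum_norm_cvs : cvs b 0 ->
  exists D, forall n, D ** g n = T n.
Proof.
move=> b0.
have [D hD] : exists D, cvs T D.
  apply: nr_complete => e e0; have e2 : 0 < e / 2 by rewrite divr_gt0.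
  have [N hN] := b0 _ e2; exists N.
  have h m n : (N <= m)%N -> (m <= n)%N -> nr (T n - T m) < e.
    move=> Nm mn; rewrite /= (big_cat_nat (leq0n m) mn)/= [X in X - _]addrC addrK.
    apply: (@le_lt_trans _ _ (e / 2)); last by rewrite ltr_pdivrMr// ltr_pMr// ltr1n.
    apply: nr_block_sum => [||i]; [exact: iota_uniq|exact: ltW|].
    rewrite mem_index_iota => /andP[mi _]; rewrite -[b i]subr0.
    by apply/ltW/hN; exact: leq_trans mi.
  move=> m n Nm Nn; have [mn|/ltnW nm] := leqP m n; last exact: h.
  by rewrite nrBC; exact: h.
exists D => m; apply: cvs_uniq (cvsMr (g m) hD) _.
apply: (eq_cvs (u := fun=> T m)); last exact: cvs_cst.
by exists m => n /block_sum_mul[].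
Qed.

End BlockSequence.

Lemma approximate_unit_identity : approximate_identity leN g.
Proof.
have gpos p : projection p -> positive (p : C).
  by move=> [ps pp]; exists p; rewrite ps pp.
split.
- split; [exact: (inhabits 0%N)|by move=> i; exact: leqnn| |].
    by move=> i j k; exact: leq_trans.
  by move=> i j; exists (maxn i j); split; [exact: leq_maxl|exact: leq_maxr].
- move=> i; have gi := approximate_unit_projection gP i; split; first exact: gpos.
  by rewrite nrE lecR nr_proj_le1.
- by move=> i j ij; apply: gpos; exact: approximate_unit_gap_projection.
move=> a eps eps0; have [_ _ /(_ a)[a1 a2]] := gP.
have eR : eps = (complex.Re eps)%:C by rewrite RRe_real// gtr0_real.
have e0 : 0 < complex.Re eps by rewrite -ltcR -eR.
have [N1 h1] := a1 _ e0; have [N2 h2] := a2 _ e0.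
exists (maxn N1 N2) => i; rewrite /leN geq_max => /andP[/h1 {}h1 /h2 {}h2].
by rewrite !nrE eR !ltcR.
Qed.

End MultiplierSums.

(** * The extension defined by the block diagonal map *)

Theorem theorem7p2 (R : realType) (A C : cstarAlgType R[i])
    (A_separable : separable A) (A_quasidiagonal : quasidiagonal A)
    (A_amenable : nuclear A)
    (C_nonunital : ~ unital C) (C_sigma_unital : sigma_unital C)
    (C_simple : simple C)
    (C_projections : has_projection_approximate_identity C)
    (C_SP : property_SP C) :
  exists tau : A -> corona C,
    essential_extension tau /\ quasidiagonal_extension tau.
Proof.
have [g [psi [gP [psilin psistar psic [psib psiM psi0]]]]] :=
  exists_asymptotic_blocks A_quasidiagonal C_nonunital C_sigma_unital
    C_projections C_simple C_SP.
pose T a n := \sum_(0 <= j < n) psi j a.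
have Tc a : coherent g (T a).
  have [M M0 hM] := psib a.
  exact: (block_sum_coherent gP (fun n => psic n a) M0).
have /choice[Phi hPhi] : forall a, exists mu : multiplier C,
    forall n, lmult mu (g n) = T a n /\ rmult mu (g n) = T a n.
  by move=> a; exact: exists_multiplier (Tc a).
have lmultB (m n : multiplier C) x : lmult (m - n) x = lmult m x - lmult n x.
  by [].
have Philin : linear Phi.
  move=> k a b; apply: (multiplier_eq_on gP) => n.
  rewrite lmultD lmultZ !(hPhi _ n).1 /T scaler_sumr -big_split.
  by apply: eq_bigr => j _; rewrite psilin.
have Phistar a : Phi (star a) = star (Phi a).
  apply: (multiplier_eq_on gP) => n.
  rewrite -[star (Phi a)]/(mult_star (Phi a)) lmult_star.
  rewrite (approximate_unit_projection gP n).1 (hPhi a n).2 (hPhi _ n).1.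
  by rewrite /T star_sum; apply: eq_bigr => j _; rewrite psistar.
have PhiM a b : exists D, Phi (a ** b) - Phi a ** Phi b = mult_of D.
  have dc n : in_corner (gap g n) (psi n (a ** b) - psi n a ** psi n b).
    by apply: in_cornerB; [exact: psic|apply: in_cornerM; exact: psic].
  have [D hD] := block_sum_norm_cvs gP dc (psiM a b).
  exists D; apply: (multiplier_eq_on gP) => n.
  rewrite lmultB -[Phi a ** Phi b]/(mult_mul (Phi a) (Phi b)) lmult_mul.
  rewrite -[RHS]/(D ** g n) hD !(hPhi _ n).1.
  have [/= _ _ LM _ _] := multiplierP (Phi a).
  (* [Phi a] is known only on the g n, so T b n is first written as g n times T b n. *)
  rewrite -(proj2 (proj2 (Tc b) _ _ (leqnn n))) LM (hPhi a n).1.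
  rewrite /T orthogonal_sumM ?iota_uniq//; last first.
    by move=> i j; apply: (gap_orthogonal gP); exact: psic.
  by rewrite -sumrB.
have [pilin piM pistar] := corona_pi_star_hom C.
exists (fun a => corona_pi (Phi a)); split; first split.
- split=> [k a b|a b|a].
  + by rewrite Philin pilin.
  + rewrite -piM; apply/corona_pi_eq/asboolP; exact: PhiM.
  + by rewrite Phistar pistar.
(* If Phi a - Phi b is c in C, the n-th block of a - b is c (g_(n+1) - g_n), which tends to 0. *)
- move=> a b /corona_pi_eq/asboolP[c hc]; apply/eqP; rewrite -subr_eq0.
  apply/eqP/psi0.
  have Tgc n : T a n - T b n = c ** g n.
    by rewrite -(hPhi a n).1 -(hPhi b n).1 -lmultB hc.
  have psiE n : psi n (a - b) = c ** g n.+1 - c ** g n.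
    rewrite -!Tgc /T !big_nat_recr//= opprD addrACA [in RHS]addrC.
    by rewrite -[a - b]addrC -scaleN1r psilin scaleN1r addrK addrC.
  have [_ _ /(_ c)[_ cg]] := gP.
  apply: (eq_cvs (u := fun n => c ** g n.+1 + (-1) *: (c ** g n))).
    by exists 0%N => n _; rewrite psiE scaleN1r.
  rewrite -(subrr c) -[in X in cvs _ (_ + X)]scaleN1r.
  by apply: cvsD; [exact: (cvs_shift cg)|exact: cvsZ].
exists g; split; first exact: approximate_unit_identity.
  exact: approximate_unit_projection.
move=> m [a _ /esym/corona_pi_eq/asboolP[c hc]].
have mE n : mult_of (g n) ** m - m ** mult_of (g n) = mult_of (g n ** c - c ** g n).
  (* Since Phi a commutes with g n, only the commutator of g n with c remains. *)
  have -> : m = mult_of c + Phi a by rewrite -hc subrK.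
  rewrite mult_of_mulr mult_of_mull lmultD rmultD (hPhi a n).1 (hPhi a n).2.
  apply: (multiplier_eq_on gP) => k; rewrite lmultB /lmult /rmult/=.
  by rewrite -amulBl; congr (_ ** _); nc.
have nE n : 0 <= mult_norm (mult_of (g n ** c - c ** g n)) <= nr (g n ** c - c ** g n).
  set d := g n ** c - _; have [/= bd _ _ _ _] := multiplierP (mult_of d).
  by rewrite opnorm_ge0//= opnorm_le ?nr_ge0// => x; exact: nrM.
have [_ _ /(_ c)[c1 c2]] := gP.
apply/cvgrPdist_lt => e e0; have e2 : 0 < e / 2 by rewrite divr_gt0.
have [N1 h1] := c1 _ e2; have [N2 h2] := c2 _ e2.
exists (maxn N1 N2) => // n /=; rewrite geq_max => /andP[/h1 {}h1 /h2 {}h2].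
rewrite sub0r normrN mE; have /andP[n0 n1] := nE n.
rewrite ger0_norm//; apply: le_lt_trans n1 _.
have := nr_tri c (g n ** c) (c ** g n); rewrite (nrBC c); lra.
Qed.
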